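(* Let $R$ be a Dedekind domain and $M$ an $R$-module. Then the following conditions are equivalent: (i) For each finite subset $F$ of $M$, there exists a countably generated pure submodule $N$ of $M$ such that $N$ is very flat and contains $F$. (ii) For each countable subset $C$ of $M$, there exists a countably generated pure submodule $N$ of $M$ such that $N$ is very flat and contains $C$. (iii) Each finite rank submodule of $M$ is very flat. (iv) Each countably generated submodule of $M$ is very flat. (v) $M$ is locally very flat.
   Context: For $r \in R$, $R[r^{-1}]$ denotes the localization of $R$ at the multiplicative set $\{1, r, r^2, \dots\}$ (viewed as an $R$-module). An $R$-module $C$ is contraadjusted if $\operatorname{Ext}^1_R(R[r^{-1}], C) = 0$ for all $r \in R$. An $R$-module $M$ is very flat if $\operatorname{Ext}^1_R(M,C) = 0$ for every contraadjusted module $C$. With $Q$ the quotient field of $R$, the rank of a module $M$ is $r(M) = \dim_Q(M \otimes_R Q)$. For a class $\mathcal C$ of modules, a $\mathcal C$-filtration of a module $M$ of length $\sigma$ (an ordinal) is an increasing chain $(M_\alpha \mid \alpha \le \sigma)$ of submodules of $M$ with $M_0 = 0$, $M_\sigma = M$, $M_\alpha = \bigcup_{\beta<\alpha} M_\beta$ for limit $\alpha \le \sigma$, and $M_{\alpha+1}/M_\alpha$ isomorphic to a module in $\mathcal C$ for each $\alpha < \sigma$. The filtration is countable if $\sigma$ is countable. A system $\mathcal S$ of countably presented submodules of a module $M$ is a dense system if $\mathcal S$ is closed under unions of well-ordered countable ascending chains, and each countable subset of $M$ is contained in some $N \in \mathcal S$. A module $M$ is locally very flat if it contains a dense system of submodules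 each of which possesses a countable $\mathcal C$-filtration, where $\mathcal C$ is the class of all countably presented very flat modules. *)

(* Defs.v *)
From HB Require Import structures.
From mathcomp Require Import all_boot all_order all_algebra.
From mathcomp Require Import generic_quotient ring_quotient.
From mathcomp Require Import boolp classical_sets cardinality wochoice.
From mathcomp Require Import ring.
From mathcomp.multinomials Require Import freeg.

Set Implicit Arguments.
Unset Strict Implicit.
Unset Printing Implicit Defensive.

Import GRing.Theory.
Local Open Scope ring_scope.
Local Open Scope classical_set_scope.
Local Open Scope quotient_scope.

Section Submodule.
Variables (R : pzRingType) (M : lmodType R) (N : submodClosed M).

Record submod : Type := Submod {submod_val :> M; _ : submod_val \in N}.

HB.instance Definition _ := [isSub for submod_val].
HB.instance Definition _ := [Choice of submod by <:].
HB.instance Definition _ := [SubChoice_isSubLmodule of submod by <:].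

(* In ssralg a [submodClosed] predicate does not inherit closure under [-%R],
   which [Quotient.quot] requires. *)
Definition submod_pred : {pred M} := fun x => x \in N.

Fact submod_pred_zmod_closed : zmod_closed submod_pred.
Proof. exact: GRing.submod_closedB (submodClosedP N). Qed.

HB.instance Definition _ :=
  GRing.isZmodClosed.Build M submod_pred submod_pred_zmod_closed.

Definition quotmod : Type := Quotient.quot submod_pred.
HB.instance Definition _ := GRing.Zmodule.on quotmod.
HB.instance Definition _ := generic_quotient.Quotient.on quotmod.

Lemma eq_quotmod (x y : M) : \pi_quotmod x = \pi_quotmod y <-> x - y \in N.
Proof.
have := Quotient.idealrBE submod_pred x y; rewrite [_ \in _]/(x - y \in N).
by move=> ->; split=> /eqP.
Qed.

Lemma quotmodP (x : quotmod) : exists y, x = \pi_quotmod y.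
Proof. by exists (repr x); rewrite reprK. Qed.

Definition quotmod_scale (a : R) (x : quotmod) : quotmod := \pi_quotmod (a *: repr x).

Lemma quotmod_scaleE a (x : M) :
  quotmod_scale a (\pi_quotmod x) = \pi_quotmod (a *: x).
Proof.
apply/eq_quotmod; rewrite -scalerBr rpredZ //.
by apply/eq_quotmod; rewrite reprK.
Qed.

Lemma quotmod_piD (x y : M) :
  \pi_quotmod x + \pi_quotmod y = \pi_quotmod (x + y).
Proof. by rewrite [RHS](@Quotient.pi_add _ submod_pred). Qed.

Fact quotmod_scaleA a b x :
  quotmod_scale a (quotmod_scale b x) = quotmod_scale (a * b) x.
Proof. by have [y ->] := quotmodP x; rewrite !quotmod_scaleE scalerA. Qed.
Fact quotmod_scale1 : left_id 1 quotmod_scale.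
Proof. by move=> x; have [y ->] := quotmodP x; rewrite quotmod_scaleE scale1r. Qed.
Fact quotmod_scaleDr : right_distributive quotmod_scale +%R.
Proof.
move=> a _x _y; have [x ->] := quotmodP _x; have [y ->] := quotmodP _y.
rewrite quotmod_piD !quotmod_scaleE.
by rewrite scalerDr quotmod_piD.
Qed.
Fact quotmod_scaleDl x : {morph quotmod_scale^~ x : a b / a + b}.
Proof.
move=> a b; have [y ->] := quotmodP x.
by rewrite !quotmod_scaleE scalerDl quotmod_piD.
Qed.

HB.instance Definition _ := GRing.Zmodule_isLmodule.Build R quotmod
  quotmod_scaleA quotmod_scale1 quotmod_scaleDr quotmod_scaleDl.

Lemma quotmod_pi_linear : linear (\pi_quotmod : M -> quotmod).
Proof.
by move=> a x y; rewrite -quotmod_piD -quotmod_scaleE.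
Qed.

End Submodule.

Section QuotientMap.
Variables (R : pzRingType) (M : lmodType R) (N : submodClosed M).

Definition quotmap (x : M) : quotmod N := \pi_(quotmod N) x.

Fact quotmap_linear : linear quotmap.
Proof. exact: quotmod_pi_linear. Qed.

HB.instance Definition _ :=
  GRing.isLinear.Build R M (quotmod N) *:%R quotmap quotmap_linear.

Lemma quotmap_surj (u : quotmod N) : exists x, u = quotmap x.
Proof. exact: quotmodP. Qed.

Lemma quotmap_eq (x y : M) : quotmap x = quotmap y <-> x - y \in N.
Proof. exact: eq_quotmod. Qed.

End QuotientMap.

Section Restriction.
Variables (R : pzRingType) (M : lmodType R) (A B : submodClosed M).

Definition subrestr : {pred submod B} := fun x => val x \in A.

Fact subrestr_closed : GRing.subsemimod_closed subrestr.
Proof.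
split; first split; rewrite /subrestr.
- by apply: etrans (rpred0 A); rewrite -(raddf0 (val : submod B -> M)).
- move=> x y xA yA; rewrite -[_ \in _]/(val (x + y) \in A) raddfD.
  exact: (@rpredD _ A) xA yA.
- move=> a x xA; rewrite -[_ \in _]/(val (a *: x) \in A) linearZ.
  exact: (@rpredZ _ _ A) xA.
Qed.

HB.instance Definition _ :=
  GRing.isSubmodClosed.Build R (submod B) subrestr subrestr_closed.

End Restriction.

(* For submodules A <= B of M, the module B / A. *)
Definition subquot (R : pzRingType) (M : lmodType R) (B A : submodClosed M) :
  lmodType R := quotmod (@subrestr R M A B).

Section Span.
Variables (R : pzRingType) (M : lmodType R) (C : set M).

Definition submod_span : {pred M} :=
  fun x => `[< forall N : submodClosed M, C `<=` [set` N] -> x \in N >].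

Fact span_closed : GRing.subsemimod_closed submod_span.
Proof.
split; first split; rewrite /submod_span.
- by apply/asboolP => N _; exact: rpred0.
- move=> x y /asboolP hx /asboolP hy; apply/asboolP => N CN.
  by apply: rpredD; [exact: hx | exact: hy].
- move=> a x /asboolP hx; apply/asboolP => N CN.
  by apply: rpredZ; exact: hx.
Qed.

HB.instance Definition _ := GRing.isSubmodClosed.Build R M submod_span span_closed.

Lemma sub_span : C `<=` [set` submod_span].
Proof. by move=> x Cx; apply/asboolP => N; exact. Qed.

Lemma span_min (N : submodClosed M) :
  C `<=` [set` N] -> [set` submod_span] `<=` [set` N].
Proof. by move=> CN x /asboolP; exact. Qed.

End Span.

Section ModuleNotions.
Variable R : comNzRingType.
Implicit Types M C A B : lmodType R.

Definition isomorphic (S : pzRingType) (U V : lmodType S) : Prop :=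
  exists f : {linear U -> V}, bijective f.

Definition generates M (X : set M) : Prop := forall x, x \in submod_span X.

Definition finitely_generated M : Prop :=
  exists2 X : set M, finite_set X & generates X.

Definition countably_generated M : Prop :=
  exists2 X : set M, countable X & generates X.

Definition countably_presented M : Prop :=
  exists (J : countType) (K : submodClosed {freeg J / R}),
    countably_generated (submod K) /\ isomorphic (quotmod K) M.

(* Purity: every finite system of linear equations with constants in N that is
   solvable in M is solvable in N. *)
Definition pure M (N : submodClosed M) : Prop :=
  forall (m n : nat) (A : 'M[R]_(m, n)) (b : 'I_m -> M),
    (forall i, b i \in N) ->
    (exists x : 'I_n -> M, forall i, \sum_j A i j *: x j = b i) ->
    exists2 x : 'I_n -> M, forall j, x j \in N &
      forall i, \sum_j A i j *: x j = b i.

(* Short exact sequences 0 -> A -> E -> C -> 0. *)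
Record extension C A := Extension {
  ext_mod : lmodType R;
  ext_in : {linear A -> ext_mod};
  ext_out : {linear ext_mod -> C};
  ext_in_inj : injective ext_in;
  ext_out_surj : forall c, exists e, ext_out e = c;
  ext_exact : forall e, ext_out e = 0 <-> exists a, ext_in a = e }.

Definition extension_equiv C A (E F : extension C A) : Prop :=
  exists2 f : {linear ext_mod E -> ext_mod F},
    forall a, f (ext_in E a) = ext_in F a &
    forall e, ext_out F (f e) = ext_out E e.

Section Split.
Variables C A : lmodType R.

Definition split_in (a : A) : A * C := (a, 0).
Definition split_out (e : A * C) : C := e.2.

Fact split_in_linear : linear split_in.
Proof. by move=> a x y; rewrite /split_in; congr pair; rewrite /= scaler0 addr0. Qed.
Fact split_out_linear : linear split_out.
Proof. by []. Qed.
HB.instance Definition _ :=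
  GRing.isLinear.Build R A (A * C)%type *:%R split_in split_in_linear.
HB.instance Definition _ :=
  GRing.isLinear.Build R (A * C)%type C *:%R split_out split_out_linear.

Fact split_in_inj : injective split_in. Proof. by move=> x y []. Qed.
Fact split_out_surj c : exists e, split_out e = c.
Proof. by exists (0, c). Qed.
Fact split_exact e : split_out e = 0 <-> exists a, split_in a = e.
Proof.
by case: e => a c; split=> [|[_ [_ <-]]//]; rewrite /split_out /= => ->; exists a.
Qed.

Definition split_extension : extension C A :=
  Extension split_in_inj split_out_surj split_exact.

End Split.

(* Ext^1(C, A) is the set of extensions of C by A up to [extension_equiv]; its
   zero element is the class of [split_extension C A]. *)
Definition Ext1_vanishes C A : Prop :=
  forall E : extension C A, extension_equiv E (split_extension C A).

End ModuleNotions.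

Section Localization.
Variables (R : comNzRingType) (r : R).

(* (a, n) stands for the fraction a / r ^ n. *)
Definition loc_equiv : rel (R * nat) := fun x y =>
  `[< exists k, r ^+ k * (r ^+ y.2 * x.1 - r ^+ x.2 * y.1) = 0 >].

Fact loc_equiv_refl : reflexive loc_equiv.
Proof. by move=> x; apply/asboolP; exists 0%N; rewrite subrr mulr0. Qed.
Fact loc_equiv_sym : symmetric loc_equiv.
Proof.
move=> x y; apply/asboolP/asboolP => -[k hk]; exists k;
  by rewrite -opprB mulrN hk oppr0.
Qed.
Fact loc_equiv_trans : transitive loc_equiv.
Proof.
move=> y x z /asboolP[k hk] /asboolP[l hl]; apply/asboolP.
exists (k + l + y.2)%N; rewrite !exprD.
transitivity (r ^+ l * r ^+ z.2 * (r ^+ k * (r ^+ y.2 * x.1 - r ^+ x.2 * y.1))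
  + r ^+ k * r ^+ x.2 * (r ^+ l * (r ^+ z.2 * y.1 - r ^+ y.2 * z.1))); first by ring.
by rewrite hk hl !mulr0 addr0.
Qed.

Canonical loc_equivRel :=
  EquivRel loc_equiv loc_equiv_refl loc_equiv_sym loc_equiv_trans.

(* The localization R[r^-1] at {1, r, r^2, ...}, as an R-module. *)
Definition localization : Type := {eq_quot loc_equiv}.
HB.instance Definition _ := Choice.on localization.
HB.instance Definition _ := generic_quotient.Quotient.on localization.

Definition loc_frac (a : R) (n : nat) : localization := \pi_localization (a, n).

Lemma loc_frac_eq a n b m : loc_frac a n = loc_frac b m <->
  exists k, r ^+ k * (r ^+ m * a - r ^+ n * b) = 0.
Proof.
rewrite /loc_frac; split.
  by move=> /eqmodP/asboolP.
by move=> h; apply/eqmodP/asboolP.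
Qed.

Lemma loc_fracP (x : localization) : exists a n, x = loc_frac a n.
Proof. by exists (repr x).1, (repr x).2; rewrite /loc_frac -surjective_pairing reprK. Qed.

Let num (x : localization) := (repr x).1.
Let exp (x : localization) := (repr x).2.

Let repr_frac a n : exists k,
  r ^+ k * (r ^+ n * num (loc_frac a n) - r ^+ exp (loc_frac a n) * a) = 0.
Proof. by apply/loc_frac_eq; rewrite /loc_frac -surjective_pairing reprK. Qed.

Definition loc_add (x y : localization) : localization :=
  loc_frac (r ^+ exp y * num x + r ^+ exp x * num y) (exp x + exp y).
Definition loc_opp (x : localization) : localization :=
  loc_frac (- num x) (exp x).
Definition loc_scale (c : R) (x : localization) : localization :=
  loc_frac (c * num x) (exp x).

Lemma loc_addE a n b m : loc_add (loc_frac a n) (loc_frac b m) =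
  loc_frac (r ^+ m * a + r ^+ n * b) (n + m).
Proof.
have [k hk] := repr_frac a n; have [l hl] := repr_frac b m.
apply/loc_frac_eq; exists (k + l)%N; rewrite !exprD.
set x := loc_frac a n in hk *; set y := loc_frac b m in hl *.
transitivity (r ^+ l * r ^+ m * r ^+ exp y *
    (r ^+ k * (r ^+ n * num x - r ^+ exp x * a)) +
  r ^+ k * r ^+ n * r ^+ exp x *
    (r ^+ l * (r ^+ m * num y - r ^+ exp y * b))); first by ring.
by rewrite hk hl !mulr0 addr0.
Qed.

Lemma loc_oppE a n : loc_opp (loc_frac a n) = loc_frac (- a) n.
Proof.
have [k hk] := repr_frac a n; apply/loc_frac_eq; exists k.
by rewrite !mulrN -opprD mulrN hk oppr0.
Qed.

Lemma loc_scaleE c a n : loc_scale c (loc_frac a n) = loc_frac (c * a) n.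
Proof.
have [k hk] := repr_frac a n; apply/loc_frac_eq; exists k.
set x := loc_frac a n in hk *.
transitivity (c * (r ^+ k * (r ^+ n * num x - r ^+ exp x * a))); first by ring.
by rewrite hk mulr0.
Qed.

Fact loc_addA : associative loc_add.
Proof.
move=> x y z; have [a [n ->]] := loc_fracP x; have [b [m ->]] := loc_fracP y.
have [c [p ->]] := loc_fracP z; rewrite !loc_addE !exprD addnA.
by congr loc_frac; ring.
Qed.
Fact loc_addC : commutative loc_add.
Proof.
move=> x y; have [a [n ->]] := loc_fracP x; have [b [m ->]] := loc_fracP y.
by rewrite !loc_addE addnC addrC.
Qed.
Fact loc_add0 : left_id (loc_frac 0 0) loc_add.
Proof.
move=> x; have [a [n ->]] := loc_fracP x.
by rewrite loc_addE mulr0 add0r expr0 mul1r.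
Qed.
Fact loc_addN : left_inverse (loc_frac 0 0) loc_opp loc_add.
Proof.
move=> x; have [a [n ->]] := loc_fracP x; rewrite loc_oppE loc_addE.
by apply/loc_frac_eq; exists 0%N; ring.
Qed.
HB.instance Definition _ :=
  GRing.isZmodule.Build localization loc_addA loc_addC loc_add0 loc_addN.

Lemma loc_fracD a n b m :
  loc_frac a n + loc_frac b m = loc_frac (r ^+ m * a + r ^+ n * b) (n + m).
Proof. exact: loc_addE. Qed.

Fact loc_scaleA a b x : loc_scale a (loc_scale b x) = loc_scale (a * b) x.
Proof. by have [c [n ->]] := loc_fracP x; rewrite !loc_scaleE mulrA. Qed.
Fact loc_scale1 : left_id 1 loc_scale.
Proof. by move=> x; have [c [n ->]] := loc_fracP x; rewrite loc_scaleE mul1r. Qed.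
Fact loc_scaleDr : right_distributive loc_scale +%R.
Proof.
move=> c x y; have [a [n ->]] := loc_fracP x; have [b [m ->]] := loc_fracP y.
rewrite loc_fracD !loc_scaleE loc_fracD.
by congr loc_frac; ring.
Qed.
Fact loc_scaleDl x : {morph loc_scale^~ x : a b / a + b}.
Proof.
move=> a b; have [c [n ->]] := loc_fracP x; rewrite !loc_scaleE.
rewrite loc_fracD; apply/loc_frac_eq; exists 0%N; rewrite exprD.
by ring.
Qed.
HB.instance Definition _ := GRing.Zmodule_isLmodule.Build R localization
  loc_scaleA loc_scale1 loc_scaleDr loc_scaleDl.

End Localization.

Section VeryFlat.
Variable R : comNzRingType.

Definition contraadjusted (C : lmodType R) : Prop :=
  forall r : R, Ext1_vanishes (localization r) C.

Definition very_flat (M : lmodType R) : Prop :=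
  forall C : lmodType R, contraadjusted C -> Ext1_vanishes M C.

End VeryFlat.

Section DedekindDomain.
Variable R : idomainType.

Definition noetherian : Prop :=
  forall I : submodClosed R^o, finitely_generated (submod I).

Definition integrally_closed : Prop :=
  forall q : {fraction R},
    integralOver (@FracField.tofrac R) q -> exists a, q = FracField.tofrac a.

(* [idealr R] is the type of proper ideals. *)
Definition maximal_ideal (P : idealr R) : Prop :=
  forall J : idealr R, {subset P <= J} -> P =i J.

Definition dedekind_domain : Prop :=
  [/\ noetherian, integrally_closed &
      forall P : prime_idealr R,
        (exists2 x, x \in P & x != 0) -> maximal_ideal P].

End DedekindDomain.

Section Rank.
Variables (R : idomainType) (M : lmodType R).
Notation K := {fraction R}.
Notation "a %:F" := (@FracField.tofrac R a) (at level 1, format "a %:F").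
Notation F := {freeg M / K}.

Definition fracmod_relators : set F :=
  [set d | (exists x y : M, d = << x + y >> - << x >> - << y >>) \/
           (exists (a : R) (x : M), d = << a *: x >> - a%:F *: << x >>)].

(* M (x)_R K as a K-vector space, K being the fraction field of R: it is
   generated over K by the x (x) 1, x in M. It has the universal property of
   the tensor product with respect to [fractens] (see [fractens_univ]). *)
Definition fracmod : lmodType K := quotmod (submod_span fracmod_relators).

Definition fractens (x : M) (q : K) : fracmod :=
  q *: quotmap (submod_span fracmod_relators) << x >>.

Definition balanced (V : zmodType) (f : M -> K -> V) : Prop :=
  [/\ forall x y q, f (x + y) q = f x q + f y q,
      forall x q p, f x (q + p) = f x q + f x p &
      forall a x q, f (a *: x) q = f x (a%:F * q)].

Lemma fractens_balanced : balanced fractens.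
Proof.
pose mk := quotmap (submod_span fracmod_relators).
have mkD x y : mk << x + y >> = mk << x >> + mk << y >>.
  rewrite -linearD; apply/quotmap_eq/sub_span.
  by left; exists x, y; rewrite opprD addrA.
have mkZ a x : mk << a *: x >> = a%:F *: mk << x >>.
  by rewrite -linearZ; apply/quotmap_eq/sub_span; right; exists a, x.
split=> [x y q|x q p|a x q]; rewrite /fractens -/mk.
- by rewrite mkD scalerDr.
- by rewrite scalerDl.
- by rewrite mkZ scalerA mulrC.
Qed.

Section Universal.
Variables (V : zmodType) (f : M -> K -> V) (balf : balanced f).

Let lift (d : F) : V := \sum_(x <- dom d) f x (coeff x d).

Let f0 x : f x 0 = 0.
Proof. by have [_ fD _] := balf; apply: (addIr (f x 0)); rewrite -fD !add0r. Qed.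

Let fN x q : f x (- q) = - f x q.
Proof.
by have [_ fD _] := balf; apply: (addIr (f x q)); rewrite -fD !addNr f0.
Qed.

Let lift_wide (s : seq M) (d : F) :
  uniq s -> {subset dom d <= s} -> lift d = \sum_(x <- s) f x (coeff x d).
Proof.
move=> us ds; rewrite [RHS](bigID (mem (dom d))) /= [X in _ + X]big1 ?addr0.
  rewrite -big_filter; apply: perm_big; apply: uniq_perm.
  - exact: uniq_dom.
  - exact: filter_uniq.
  - move=> x; rewrite mem_filter; apply/idP/andP => [xd|[]//].
    by split=> //; exact: ds.
by move=> x xd; rewrite coeff_outdom.
Qed.

Let liftD (d e : F) : lift (d + e) = lift d + lift e.
Proof.
have [_ fD _] := balf; pose s := undup (dom d ++ dom e).
have us : uniq s by exact: undup_uniq.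
have ds : {subset dom d <= s} by move=> x xd; rewrite mem_undup mem_cat xd.
have es : {subset dom e <= s} by move=> x xe; rewrite mem_undup mem_cat xe orbT.
rewrite (lift_wide us ds) (lift_wide us es) -big_split (@lift_wide s) //=.
  by apply: eq_bigr => x _; rewrite coeffD fD.
by move=> x /domD_subset; rewrite mem_undup.
Qed.

Let liftU x q : lift (q *: << x >>) = f x q.
Proof.
rewrite (@lift_wide [:: x]) //.
  by rewrite big_seq1 coeffZ coeffU eqxx !mulr1.
by move=> y /domZ_subset; rewrite domU1.
Qed.

Let liftN d : lift (- d) = - lift d.
Proof.
rewrite (@lift_wide (dom d)) ?uniq_dom//; last by move=> x; rewrite domN.
by rewrite /lift -sumrN; apply: eq_bigr => x _; rewrite coeffN fN.
Qed.

Let ker : {pred F} := fun d => `[< forall q, lift (q *: d) = 0 >].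

Let ker_closed : GRing.subsemimod_closed ker.
Proof.
have l0 : lift 0 = 0.
  by apply: (addIr (lift 0)); rewrite -liftD !add0r.
split; first split.
- by apply/asboolP => q; rewrite scaler0.
- move=> d e /asboolP hd /asboolP he; apply/asboolP => q.
  by rewrite scalerDr liftD hd he addr0.
- by move=> a d /asboolP hd; apply/asboolP => q; rewrite scalerA.
Qed.

HB.instance Definition _ := GRing.isSubmodClosed.Build K F ker ker_closed.

Let lift_span (d : F) : d \in submod_span fracmod_relators -> lift d = 0.
Proof.
have [fDl fDr fZ] := balf.
move=> hd; rewrite -[d]scale1r.
suff /(span_min (N := ker))/(_ d hd)/asboolP : fracmod_relators `<=` [set` ker].
  by apply.
move=> e [[x [y ->]]|[a [x ->]]]; apply/asboolP => q.
  by rewrite !scalerBr !liftD !liftN !liftU fDl addrAC addrK subrr.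
by rewrite scalerBr liftD liftN scalerA !liftU fZ mulrC subrr.
Qed.

Lemma fractens_univ :
  exists2 g : {additive fracmod -> V}, forall x q, g (fractens x q) = f x q &
    forall h : {additive fracmod -> V},
      (forall x q, h (fractens x q) = f x q) -> g =1 h.
Proof.
pose g (u : fracmod) : V := lift (repr (u : quotmod (submod_span fracmod_relators))).
have gE d : g (quotmap (submod_span fracmod_relators) d) = lift d.
  apply/eqP; rewrite -subr_eq0 -liftN -liftD; apply/eqP/lift_span.
  by apply/quotmap_eq; rewrite /quotmap reprK.
have gB : zmod_morphism g.
  move=> u v; have [d ->] := quotmap_surj u; have [e ->] := quotmap_surj v.
  by rewrite -linearB !gE liftD liftN.
pose gM := GRing.isZmodMorphism.Build fracmod V g gB.
pose G : {additive fracmod -> V} := HB.pack g gM.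
exists G => [x q|H HE].
  by rewrite /fractens -linearZ [LHS]gE liftU.
move=> u; have [d ->] := quotmap_surj u.
rewrite [LHS]gE -[d in RHS]freeg_sumE linear_sum raddf_sum.
apply: eq_bigr => x _; rewrite -HE /fractens -linearZ; congr (H (quotmap _ _)).
by apply/eqP/freeg_eqP => y; rewrite coeffZ !coeffU mul1r.
Qed.

End Universal.

Definition has_rank (n : nat) : Prop := isomorphic fracmod 'rV[K]_n.

Definition finite_rank : Prop := exists n, has_rank n.

End Rank.

Section LocallyVeryFlat.
Variable R : comNzRingType.
Implicit Type M : lmodType R.

Definition is_succ d (T : orderType d) (a b : T) : Prop :=
  (a < b)%O /\ forall c, (a < c)%O -> (b <= c)%O.

Definition is_limit d (T : bOrderType d) (b : T) : Prop :=
  b <> \bot%O /\ ~ exists a, is_succ a b.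

(* The well-ordered set T with greatest element stands for the ordinals
   {alpha | alpha <= sigma}; [\bot] is 0 and [\top] is sigma. *)
Definition filtration (P : lmodType R -> Prop) M d (T : tbOrderType d)
    (F : T -> submodClosed M) : Prop :=
  [/\ well_order (<=%O : rel T),
      forall a b, (a <= b)%O -> {subset F a <= F b},
      forall x, (x \in F \bot%O <-> x = 0) /\ x \in F \top%O,
      forall b, is_limit b ->
        forall x, x \in F b <-> exists2 a, (a < b)%O & x \in F a &
      forall a b, is_succ a b ->
        exists2 U, P U & isomorphic (subquot (F b) (F a)) U].

Definition countably_filtered (P : lmodType R -> Prop) M : Prop :=
  exists d (T : tbOrderType d) (F : T -> submodClosed M),
    countable [set: T] /\ filtration P F.

Definition dense_system M (S : submodClosed M -> Prop) : Prop :=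
  [/\ forall N, S N -> countably_presented (submod N),
      forall d (T : orderType d) (F : T -> submodClosed M),
        well_order (<=%O : rel T) -> countable [set: T] -> [set: T] !=set0 ->
        (forall a b, (a <= b)%O -> {subset F a <= F b}) ->
        (forall a, S (F a)) ->
        exists2 N, S N & forall x, x \in N <-> exists a, x \in F a &
      forall C : set M, countable C -> exists2 N, S N & C `<=` [set` N]].

Definition locally_very_flat M : Prop :=
  exists2 S : submodClosed M -> Prop, dense_system S &
    forall N, S N -> countably_filtered
      (fun U => countably_presented U /\ very_flat U) (submod N).

End LocallyVeryFlat.

(* Main.v *)
(* A countably generated module is a quotient of the free module {poly R}, so
   very flatness of it says that every map from the kernel to a contraadjusted
   module D extends to {poly R}. Over a Dedekind domain submodules of {poly R}
   are projective, hence very flatness passes to countably generated submodules.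

   All five conditions are compared with the condition that each countably
   generated submodule of finite rank of M is very flat, which follows from each
   of them rather directly. Conversely, assume it. If F is a finitely generated
   submodule and y_i are elements of its torsion closure whose annihilators
   modulo F are infinitely many distinct maximal ideals P_i, then the
   contraadjusted module (+) R / P_i shows that the span of F and the y_i is not
   very flat. So only finitely many P_i occur, and the torsion closure of F is
   contained in F[s^-1] for a single s <> 0. Consequently, if N_n denotes the
   torsion closure of the first n terms of a sequence, N_{n+1} / N_n embeds into
   some R[s^-1] and is very flat and countably generated, and so is the union of
   the N_n, which is a pure submodule containing the whole sequence. *)
Require Import Defs.
From HB Require Import structures.
From mathcomp Require Import all_boot all_order all_algebra.
From mathcomp Require Import boolp classical_sets cardinality.
From mathcomp Require Import ring_quotient wochoice.
From mathcomp Require Import ring.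
From mathcomp.multinomials Require Import freeg.

Set Implicit Arguments.
Unset Strict Implicit.
Unset Printing Implicit Defensive.

Import Order.TTheory GRing.Theory.
Local Open Scope ring_scope.
Local Open Scope classical_set_scope.

(** * Submodules as sets, and maps linear on a set *)

Section PartialLinear.
Variable R : comNzRingType.
Implicit Types X Y : lmodType R.

(** Submodules are sets and homomorphisms are total functions that are linear on such a set, so that
    chains, preimages and partial maps all live in one ambient type. Of [{poly R}] only the module
    structure with basis ['X^i] matters: its filtration by size reduces questions about a submodule
    to the ideals of its leading coefficients. The dual basis of an invertible ideal is then used
    twice: it gives the projectivity of submodules of [{poly R}], and for a nonzero prime [P] it
    gives a map [P -> R] whose image is not inside [P], that is, a nonzero class in Ext^1(R / P, R /
    P). The finiteness argument plays infinitely many such classes against one finitely generated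
    span: a map from that span to a direct sum meets only finitely many components, so it cannot
    correct all classes at once. With a product in place of the direct sum this argument would break
    down. *)

Definition is_submod X (A : set X) : Prop :=
  A 0 /\ forall a x y, A x -> A y -> A (a *: x + y).

Definition lin_on X Y (A : set X) (f : X -> Y) : Prop :=
  forall a x y, A x -> A y -> f (a *: x + y) = a *: f x + f y.

Section Submod.
Variables (X : lmodType R) (A : set X) (sA : is_submod A).

Lemma is_submod0 : A 0. Proof. by case: sA. Qed.
Lemma is_submodZD a x y : A x -> A y -> A (a *: x + y).
Proof. by case: sA => _; apply. Qed.
Lemma is_submodD x y : A x -> A y -> A (x + y).
Proof. by move=> Ax Ay; rewrite -[x]scale1r; apply: is_submodZD. Qed.
Lemma is_submodZ a x : A x -> A (a *: x).
Proof. by move=> Ax; rewrite -[_ *: _]addr0; apply: is_submodZD is_submod0. Qed.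
Lemma is_submodN x : A x -> A (- x).
Proof. by move=> Ax; rewrite -scaleN1r; apply: is_submodZ. Qed.
Lemma is_submodB x y : A x -> A y -> A (x - y).
Proof. by move=> Ax Ay; apply: is_submodD => //; apply: is_submodN. Qed.
Lemma is_submod_sum I (r : seq I) (P : pred I) (F : I -> X) :
  (forall i, P i -> A (F i)) -> A (\sum_(i <- r | P i) F i).
Proof. by move=> AF; elim/big_ind: _ => //; [exact: is_submod0 | exact: is_submodD]. Qed.

Variables (Y : lmodType R) (f : X -> Y) (lf : lin_on A f).

Lemma lin_onD x y : A x -> A y -> f (x + y) = f x + f y.
Proof. by move=> Ax Ay; rewrite -[x in LHS]scale1r lf// scale1r. Qed.
Lemma lin_on0 : f 0 = 0.
Proof.
have A0 := is_submod0; apply: (addrI (f 0)); rewrite -lin_onD//.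
by rewrite !addr0.
Qed.
Lemma lin_onZ a x : A x -> f (a *: x) = a *: f x.
Proof.
by move=> Ax; rewrite -[_ *: x]addr0 lf ?lin_on0 ?addr0//; exact: is_submod0.
Qed.
Lemma lin_onN x : A x -> f (- x) = - f x.
Proof. by move=> Ax; rewrite -scaleN1r lin_onZ// scaleN1r. Qed.
Lemma lin_onB x y : A x -> A y -> f (x - y) = f x - f y.
Proof. by move=> Ax Ay; rewrite lin_onD ?lin_onN//; exact: is_submodN. Qed.
Lemma lin_on_sum I (r : seq I) (P : pred I) (F : I -> X) :
  (forall i, P i -> A (F i)) ->
  f (\sum_(i <- r | P i) F i) = \sum_(i <- r | P i) f (F i).
Proof.
move=> AF; suff [] : A (\sum_(i <- r | P i) F i) /\
  f (\sum_(i <- r | P i) F i) = \sum_(i <- r | P i) f (F i) by [].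
elim/big_rec2: _ => [|i y1 y2 Pi [Ay1 <-]]; first by split; [exact: is_submod0 | exact: lin_on0].
by split; [apply: is_submodD => //; exact: AF | rewrite lin_onD//; exact: AF].
Qed.
End Submod.

Lemma is_submodT X : is_submod [set: X]. Proof. by []. Qed.
Lemma is_submod_0 X : is_submod [set (0 : X)].
Proof. by split=> // a x y -> ->; rewrite scaler0 addr0. Qed.
Lemma is_submod_preimage X Y (f : {linear X -> Y}) (A : set Y) :
  is_submod A -> is_submod (f @^-1` A).
Proof.
by move=> [A0 sA]; split=> [|a x y fx fy]; rewrite /preimage/= ?linear0// linearP; apply: sA.
Qed.
Lemma is_submod_image X Y (A : set X) (f : X -> Y) : is_submod A -> lin_on A f ->
  is_submod (f @` A).
Proof.
move=> sA lf; split=> [|a _ _ [x Ax <-] [y Ay <-]].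
  by exists 0; [exact: is_submod0 | exact: (lin_on0 sA lf)].
by exists (a *: x + y); [exact: is_submodZD | rewrite lf].
Qed.
Lemma lin_onW X Y (f : {linear X -> Y}) (A : set X) : lin_on A f.
Proof. by move=> a x y _ _; rewrite linearP. Qed.
Lemma lin_on_linear X Y (f : X -> Y) : lin_on [set: X] f ->
  exists g : {linear X -> Y}, g =1 f.
Proof.
move=> lf.
have l : linear f by move=> a x y; apply: lf.
pose fM := GRing.isLinear.Build R X Y *:%R f l.
by exists (HB.pack f fM : {linear X -> Y}).
Qed.

Section MkSubmod.
Variables (X : lmodType R) (A : set X) (sA : is_submod A).

Definition mk_pred : {pred X} := fun x => `[< A x >].

Let mk_predE x : (x \in mk_pred) = `[< A x >]. Proof. by []. Qed.

Fact mk_closed : GRing.subsemimod_closed mk_pred.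
Proof.
split; first split; rewrite ?mk_predE.
- by apply/asboolP; exact: is_submod0.
- move=> x y; rewrite !mk_predE => /asboolP Ax /asboolP Ay.
  by apply/asboolP; exact: is_submodD.
- by move=> a x; rewrite !mk_predE => /asboolP Ax; apply/asboolP; exact: is_submodZ.
Qed.

Definition mk_submod : submodClosed X :=
  HB.pack mk_pred (GRing.isSubmodClosed.Build R X mk_pred mk_closed).

Lemma mk_submodE x : x \in mk_submod <-> A x.
Proof. by split=> /asboolP. Qed.

End MkSubmod.

Lemma submodClosed_is_submod X (N : submodClosed X) : is_submod [set` N].
Proof. by split=> [|a x y Nx Ny]; rewrite /=; [exact: rpred0 | exact: rpredD (rpredZ _ Nx) Ny]. Qed.

(** * The free module [{poly R}] and its maps *)

Section Ev.
Variables (X : lmodType R) (c : nat -> X).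

(** The linear map given on the basis by ['X^i |-> c i]; its range is the submodule generated by the
    sequence. *)
Definition ev (p : {poly R}) : X := \sum_(i < size p) p`_i *: c i.

Lemma evE n (p : {poly R}) : (size p <= n)%N -> ev p = \sum_(i < n) p`_i *: c i.
Proof.
move=> pn; rewrite /ev (big_ord_widen n (fun i => p`_i *: c i) pn) big_mkcond /=.
by apply: eq_bigr => i _; case: ltnP => // pi; rewrite nth_default// scale0r.
Qed.

Fact ev_linear : linear ev.
Proof.
move=> a p q; pose n := maxn (size p) (size q).
rewrite (@evE n (a *: p + q)); last first.
  apply: leq_trans (size_polyD _ _) _; rewrite geq_max leq_maxr andbT.
  exact: leq_trans (size_scale_leq _ _) (leq_maxl _ _).
rewrite (@evE n p) ?leq_maxl// (@evE n q) ?leq_maxr// scaler_sumr -big_split /=.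
by apply: eq_bigr => i _; rewrite coefD coefZ scalerDl scalerA.
Qed.

HB.instance Definition _ := GRing.isLinear.Build R {poly R} X *:%R ev ev_linear.

Lemma evX i : ev 'X^i = c i.
Proof.
rewrite (@evE i.+1) ?size_polyXn// big_ord_recr /= big1 => [|j _].
  by rewrite coefXn eqxx scale1r add0r.
by rewrite coefXn ltn_eqF// scale0r.
Qed.

Lemma ev_in (A : set X) : is_submod A -> (forall i, A (c i)) -> forall p, A (ev p).
Proof. by move=> sA Ac p; apply: is_submod_sum => // i _; apply: is_submodZ. Qed.

Lemma ev_in_size n (A : set X) : is_submod A -> (forall i, (i < n)%N -> A (c i)) ->
  forall p : {poly R}, (size p <= n)%N -> A (ev p).
Proof.
move=> sA Ac p pn; rewrite (evE pn); apply: is_submod_sum => // i _.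
by apply: is_submodZ => //; exact: Ac.
Qed.

Lemma ev_recr n (p : {poly R}) : (size p <= n.+1)%N ->
  exists2 q : {poly R}, (size q <= n)%N & ev p = p`_n *: c n + ev q.
Proof.
move=> pn; exists (p - p`_n *: 'X^n).
  apply/leq_sizeP => j nj; rewrite coefB coefZ coefXn.
  case: eqVneq => [->|jn]; first by rewrite mulr1 subrr.
  rewrite mulr0 subr0 nth_default//; apply: leq_trans pn _.
  by rewrite ltn_neqAle eq_sym jn.
by rewrite linearB linearZ /= evX addrC subrK.
Qed.

End Ev.

Lemma lin_on_ev X Y (A : set X) (f : X -> Y) c : is_submod A -> lin_on A f ->
  (forall i, A (c i)) -> forall p, f (ev c p) = ev (f \o c) p.
Proof.
move=> sA lf Ac p; rewrite /ev (lin_on_sum sA lf) => [|i _]; last exact: is_submodZ.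
by apply: eq_bigr => i _; rewrite (lin_onZ sA lf).
Qed.

Lemma linear_ev X Y (f : {linear X -> Y}) c p : f (ev c p) = ev (f \o c) p.
Proof. by apply: (@lin_on_ev _ _ setT) => //; exact: lin_onW. Qed.

Lemma eq_ev X (c d : nat -> X) : c =1 d -> ev c =1 ev d.
Proof. by move=> cd p; apply: eq_bigr => i _; rewrite cd. Qed.

Definition ctbl_gen X (A : set X) : Prop :=
  exists2 c : nat -> X, forall i, A (c i) & forall x, A x -> exists p, x = ev c p.

(* For B / A = U, this says that Hom(B, D) -> Hom(A, D) is onto; when B is
   projective it amounts to Ext^1(U, D) = 0. *)
Definition extends X (D : lmodType R) (A B : set X) : Prop :=
  forall f : X -> D, lin_on A f -> exists2 h : X -> D, lin_on B h & forall x, A x -> h x = f x.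

Definition ker X Y (f : X -> Y) : set X := [set x | f x = 0].

Lemma is_submod_ker X Y (f : {linear X -> Y}) : is_submod (ker f).
Proof. by split=> [|a x y fx fy]; rewrite /ker/= ?linear0// linearP fx fy scaler0 addr0. Qed.

End PartialLinear.

(** * Finite and countable generation through sequences *)

Section Generation.
Variable R : comNzRingType.
Implicit Types X U : lmodType R.

Lemma is_submod_range_ev X (c : nat -> X) : is_submod (range (ev c)).
Proof. by apply: is_submod_image; [exact: is_submodT | exact: lin_onW]. Qed.

Lemma span_ev X (c : nat -> X) n (C : set X) :
  C `<=` [set x | exists2 p : {poly R}, (size p <= n)%N & x = ev c p] ->
  forall x, x \in submod_span C -> exists2 p : {poly R}, (size p <= n)%N & x = ev c p.
Proof.
move=> CA; set A := [set x | _] in CA.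
have sA : is_submod A.
  split=> [|a _ _ [p pn ->] [q qn ->]]; first by exists 0; rewrite ?size_poly0 ?linear0.
  exists (a *: p + q); last by rewrite linearP.
  apply: leq_trans (size_polyD _ _) _; rewrite geq_max qn andbT.
  exact: leq_trans (size_scale_leq _ _) pn.
move=> x xC; apply/(mk_submodE sA); move: x xC; apply: (@span_min _ _ _ (mk_submod sA)).
by move=> z /CA Az; apply/mk_submodE.
Qed.

Lemma fin_gen_ev U : finitely_generated U ->
  exists n (c : nat -> U), forall x, exists2 p : {poly R}, (size p <= n)%N & x = ev c p.
Proof.
move=> [X /finite_seqP[s ->] gX]; exists (size s), (nth 0 s) => x.
apply: (span_ev _ (gX x)) => {}x /= xs; exists 'X^(index x s).
  by rewrite size_polyXn index_mem.
by rewrite evX nth_index.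
Qed.

Lemma countable_enum U (X : set U) : countable X ->
  exists2 c : nat -> U, forall x, X x -> exists i, x = c i & forall i, X (c i) \/ c i = 0.
Proof.
move=> /countable_injP[f finj].
(* Indices outside the image of the injection [f] get the value 0, so that the empty set is
   enumerated too. *)
have /choice[c cP] n : exists y, (X y /\ f y = n) \/ (y = 0 /\ ~ exists2 x, X x & f x = n).
  have [[x Xx fx]|h] := pselect (exists2 x, X x & f x = n); first by exists x; left.
  by exists 0; right.
exists c => [x Xx|i]; last by case: (cP i) => -[]; [left|right].
exists (f x); case: (cP (f x)) => [[Xc fc]|[_ []]]; last by exists x.
by apply: finj; rewrite ?inE.
Qed.

Lemma ctbl_gen_ev U : countably_generated U <->
  exists c : nat -> U, forall x, exists p : {poly R}, x = ev c p.
Proof.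
split=> [[X /countable_enum[c Xc _] gX]|[c gc]].
  exists c => x; have := gX x => /asboolP/(_ (mk_submod (is_submod_range_ev c))).
  case/(_ _)/mk_submodE; last by move=> p _ <-; exists p.
  by move=> y /Xc[i ->]; apply/mk_submodE; exists 'X^i => //; rewrite evX.
exists (range c); first exact: card_image_le.
move=> x; have [p ->] := gc x; apply: rpred_sum => i _; apply: rpredZ.
have ci : range c (c i) by exists i.
exact: (Defs.sub_span ci).
Qed.

Lemma ctbl_gen_submod X (N : submodClosed X) :
  countably_generated (submod N) <-> ctbl_gen [set` N].
Proof.
split=> [/ctbl_gen_ev[c gc]|[c Nc gc]].
  exists (val \o c) => [i|x Nx]; first exact: valP.
  have [p xp] := gc (Sub x Nx); exists p.
  by rewrite -linear_ev -xp.
apply/ctbl_gen_ev; exists (fun i => Sub (c i) (Nc i) : submod N) => x.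
have [p xp] := gc (val x) (valP x); exists p; apply: val_inj.
by rewrite linear_ev xp; exact: eq_ev.
Qed.

End Generation.

(** * Ideals of a noetherian domain *)

Section Ideals.
Variable R : idomainType.
Hypothesis noethR : noetherian R.
Implicit Types I J P : set R^o.

Lemma ideal_fin_gen I : is_submod I ->
  exists n (c : nat -> R^o), (forall i, I (c i)) /\
    forall x, I x -> exists2 p : {poly R}, (size p <= n)%N & x = ev c p.
Proof.
move=> sI; have [n [c gc]] := fin_gen_ev (noethR (mk_submod sI)).
exists n, (val \o c); split=> [i|x Ix]; first exact/mk_submodE/(valP (c i)).
have Nx : x \in mk_submod sI by apply/mk_submodE.
have [p pn xp] := gc (Sub x Nx); exists p => //.
by rewrite -linear_ev -xp.
Qed.

(** Without a maximal member, choice yields a strictly increasing sequence in [Q]; its union is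
    finitely generated and hence equal to one of its terms. *)
Lemma noetherian_max (Q : set (set R^o)) I0 : Q I0 -> (forall I, Q I -> is_submod I) ->
  exists2 I, Q I & forall J, Q J -> I `<=` J -> J `<=` I.
Proof.
move=> Q0 QI; apply: contrapT => nomax.
have next (I : {I | Q I}) : exists J : {J | Q J}, sval I `<=` sval J /\ ~ sval J `<=` sval I.
  apply: contrapT => h; apply: nomax; exists (sval I); first exact: (svalP I).
  move=> J QJ IJ; apply: contrapT => JI; apply: h.
  by exists (exist _ J QJ).
have [f fP] := choice next.
pose u n := iter n f (exist _ I0 Q0).
have uS n : sval (u n) `<=` sval (u n.+1) by case: (fP (u n)).
have umono m n : (m <= n)%N -> sval (u m) `<=` sval (u n).
  move=> mn; rewrite -(subnK mn); elim: (n - m)%N => // k IHk; rewrite addSn.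
  by apply: subset_trans (uS _).
have sU : is_submod (\bigcup_n sval (u n)).
  split=> [|a x y [m _ xm] [n _ yn]].
    by exists 0%N => //; apply: is_submod0; exact: QI (svalP (u 0%N)).
  exists (maxn m n) => //; apply: is_submodZD; first exact: QI (svalP (u _)).
    by apply: (umono m) xm; rewrite leq_maxl.
  by apply: (umono n) yn; rewrite leq_maxr.
have [n [c [Uc gc]]] := ideal_fin_gen sU.
have [k kP] : exists k, forall i, (i < n)%N -> sval (u k) (c i).
  elim: n {gc} => [|n [k kP]]; first by exists 0%N.
  have [m _ cm] := Uc n; exists (maxn k m) => i; rewrite ltnS leq_eqVlt => /predU1P[->|/kP].
    by apply: umono cm; rewrite leq_maxr.
  by apply: umono; rewrite leq_maxl.
have [_] := fP (u k); apply=> x xk.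
have /gc[p pn ->] : (\bigcup_n sval (u n)) x by exists k.+1.
by apply: ev_in_size pn => //; exact: QI (svalP (u k)).
Qed.

(* The choice of an associated prime: a maximal annihilator among those
   avoiding the multiplicative set [S]. *)
Lemma prime_colon (M : lmodType R) (F : set M) (S : set R) (y0 : M) :
  is_submod F -> S 1 -> (forall a b, S a -> S b -> S (a * b)) ->
  (forall s, S s -> ~ F (s *: y0)) ->
  exists r, let y := r *: y0 in
    (forall s, S s -> ~ F (s *: y)) /\
    (forall a b, F ((a * b) *: y) -> F (a *: y) \/ F (b *: y)).
Proof.
move=> sF S1 SM Sy0.
pose col (y : M) : set R^o := [set a | F (a *: y)].
have scol y : is_submod (col y).
  split=> [|a u v Fu Fv]; rewrite /col/=; first by rewrite scale0r; exact: is_submod0.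
  by rewrite scalerDl -scalerA; apply: is_submodZD.
pose Q := [set I | exists2 r, I = col (r *: y0) & forall s, S s -> ~ F (s *: (r *: y0))].
have Q0 : Q (col y0) by exists 1; rewrite ?scale1r.
have Qs I : Q I -> is_submod I by move=> [r -> _]; exact: scol.
have [_ [r -> Sr] maxr] := noetherian_max Q0 Qs.
exists r; split=> // a b Fab; apply: contrapT => /not_orP[Fa Fb].
have maxt t : (forall s, S s -> ~ F (s *: ((t * r) *: y0))) ->
    forall d, F (d *: ((t * r) *: y0)) -> F (d *: (r *: y0)).
  move=> St; apply: (maxr (col ((t * r) *: y0))); first by exists (t * r).
  move=> d Fd; rewrite /col/= -scalerA [_ *: (t *: _)]scalerA mulrC -scalerA.
  exact: is_submodZ.
(* If some [s] in [S] sends [a *: y] into [F], then [s *: y] still avoids [S] and by maximality has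
   the annihilator of [y], which thus contains [a]. Otherwise the same reasoning applies to [a *: y]
   and [b]. *)
have [[s Ss Fs]|h] := pselect (exists2 s, S s & F (s *: ((a * r) *: y0))).
  apply: Fa; apply: (maxt s) => [t St|]; last first.
    by move: Fs; rewrite !scalerA; congr (F (_ *: _)); ring.
  by rewrite -[(s * r) *: y0]scalerA [t *: (s *: _)]scalerA; exact/Sr/SM.
apply: Fb; apply: (maxt a) => [t St Ft|]; first by apply: h; exists t.
by move: Fab; rewrite !scalerA; congr (F (_ *: _)); ring.
Qed.

Definition max_or_unit P : Prop := forall x, ~ P x -> exists y, P (1 - y * x).

Definition prime_ideal P : Prop :=
  [/\ is_submod P, ~ P 1 & forall a b : R, P (a * b) -> P a \/ P b].

Fact idealr_of_subproof P : is_submod P -> ~ P 1 ->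
  idealr_closed (fun x : R => `[< P x >]).
Proof.
move=> sP P1; split; first by apply/asboolP; exact: is_submod0 sP.
  by apply/negP => /asboolP.
by move=> a u v /asboolP Pu /asboolP Pv; apply/asboolP/(is_submodZD sP).
Qed.

End Ideals.

(** * Invertibility of ideals in a Dedekind domain *)

Section Dedekind.
Variable R : idomainType.
Hypothesis hR : dedekind_domain R.
Implicit Types I J P : set R^o.

Lemma dedekind_noetherian : noetherian R. Proof. by case: hR. Qed.

Lemma prime_maximal P (a : R) : prime_ideal P -> P a -> a != 0 -> max_or_unit P.
Proof.
move=> [sP P1 Pp] Pa a0 x Px; apply: contrapT => nox.
pose J : set R^o := [set z | exists y : R, P (z - y * x)].
have sJ : is_submod J.
  split=> [|c u v [y Pu] [z Pv]]; first by exists 0; rewrite mul0r subr0; exact: (is_submod0 sP).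
  exists (c * y + z).
  have -> : c *: u + v - (c * y + z) * x = c *: (u - y * x : R^o) + (v - z * x).
    by rewrite /GRing.scale/=; ring.
  exact: is_submodZD.
have J1 : ~ J 1 by move=> [y Py]; apply: nox; exists y.
have [_ _ maxR] := hR.
have prP : prime_idealr_closed (fun x : R => `[< P x >]).
  by move=> u v /asboolP/Pp[] /asboolP Pu; apply/orP; [left|right].
pose PP : prime_idealr R := HB.pack (fun x : R => `[< P x >])
  (isIdealr.Build R (fun x : R => `[< P x >]) (@idealr_of_subproof R P sP P1))
  (isPrimeIdealrClosed.Build R (fun x : R => `[< P x >]) prP).
pose JJ : idealr R := HB.pack (fun x : R => `[< J x >])
  (isIdealr.Build R (fun x : R => `[< J x >]) (@idealr_of_subproof R J sJ J1)).
have /(_ JJ) : maximal_ideal PP.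
  by apply: maxR; exists a => //; apply/asboolP.
have PJ : {subset PP <= JJ}.
  by move=> z /asboolP Pz; apply/asboolP; exists 0; rewrite mul0r subr0.
move=> /(_ PJ x) /esym; have -> : x \in JJ.
  by apply/asboolP; exists 1; rewrite mul1r subrr; exact: (is_submod0 sP).
by move=> /esym/asboolP.
Qed.

(** Determinant trick: multiplication by [c / b] preserves [I], so the row of generators of [I] is
    an eigenvector over the fraction field. Hence [c / b] is a root of a monic characteristic
    polynomial over [R], and integral closedness applies. *)
Lemma integral_quotient I (b c d : R) : is_submod I -> I d -> d != 0 -> b != 0 ->
  (forall x : R, I x -> exists2 y : R, I y & c * x = b * y) -> exists r, c = r * b.
Proof.
move=> sI Id d0 b0 Icb; have [_ icR _] := hR.
have [n [g [Ig gI]]] := ideal_fin_gen dedekind_noetherian sI.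
have /choice[A AP] (i : nat) : exists p : {poly R},
    (size p <= n)%N /\ c * (g i : R) = b * (ev g p : R).
  have [y /gI[p pn ->] e] := Icb _ (Ig i); by exists p.
pose B : 'M[{fraction R}]_n := \matrix_(j, i) FracField.tofrac (A i)`_j.
pose q := FracField.tofrac c / FracField.tofrac b.
have bF : FracField.tofrac b != 0 by rewrite tofrac_eq0.
have [r qr] : exists r, q = FracField.tofrac r.
  apply: icR; exists (char_poly (\matrix_(j, i) (A i)`_j : 'M[R]_n)); first exact: char_poly_monic.
  have -> : map_poly (@FracField.tofrac R) (char_poly (\matrix_(j, i) (A i)`_j : 'M[R]_n))
    = char_poly B.
    rewrite map_char_poly; congr char_poly; apply/matrixP => i j; by rewrite !mxE.
  rewrite -eigenvalue_root_char; apply/eigenvalueP.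
  exists (\row_i FracField.tofrac (g i : R)).
    apply/rowP => i; rewrite !mxE; have [pn e] := AP i.
    apply: (mulfI bF); rewrite /q mulrA mulrCA mulfV// mulr1 -tofracM e.
    rewrite (evE _ pn) tofracM; congr (_ * _).
    rewrite raddf_sum /=; apply: eq_bigr => j _.
    by rewrite !mxE -tofracM mulrC.
  apply: contraNN d0 => /eqP/rowP g0.
  have [p pn ->] := gI _ Id; rewrite (evE _ pn) big1// => i _.
  have := g0 i; rewrite !mxE => /eqP; rewrite tofrac_eq0 => /eqP ->.
  by rewrite scaler0.
exists r; apply/eqP; rewrite -tofrac_eq tofracM -qr /q mulfVK//.
Qed.

(** Each [lam j] is multiplication by an element of the inverse fractional ideal, and the [a j] with
    the [lam j] form a dual basis of [I]. *)
Lemma ideal_dual I (b : R) : is_submod I -> I b -> b != 0 ->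
  exists n (a : nat -> R) (lam : nat -> R -> R),
    [/\ forall j, I (a j), forall j, lin_on I (lam j : R^o -> R^o),
        \sum_(j < n) lam j (a j) = 1 &
        forall x : R, I x -> x = \sum_(j < n) lam j x * a j].
Proof.
move=> sI Ib b0.
(* [I'] is [b] times the inverse of [I], so that [J] below is the product of [I] and its inverse. *)
pose I' : set R^o := [set c | forall a : R, I a -> exists y : R, c * a = b * y].
have sI' : is_submod I'.
  split=> [a _|r x y Ix Iy a Ia]; first by exists 0; rewrite mul0r mulr0.
  have [u xu] := Ix a Ia; have [v yv] := Iy a Ia; exists (r * u + v).
  by rewrite /GRing.scale/= mulrDl -mulrA xu yv; ring.
have I'b : I' b by move=> a _; exists a.
pose ok (s : seq (R * R)) := forall u, u \in s -> I' u.1 /\ I u.2.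
pose J : set R^o := [set x | exists2 s, ok s & x * b = \sum_(u <- s) u.1 * u.2 :> R].
have sJ : is_submod J.
  split=> [|r x y [s ss xs] [t tt yt]]; first by exists [::] => //; rewrite mul0r big_nil.
  exists ([seq (r * u.1, u.2) | u <- s] ++ t).
    move=> u; rewrite mem_cat => /orP[/mapP[v /ss[? ?] ->]/=|/tt//].
    by split=> //; apply: (is_submodZ sI').
  rewrite big_cat /= big_map -yt /GRing.scale/= mulrDl; congr (_ + _).
  by rewrite -mulrA xs mulr_sumr; apply: eq_bigr => u _ /=; rewrite mulrA.
have IJ (c a y : R) : I' c -> I a -> c * a = b * y -> J y.
  move=> Ic Ia e; exists [:: (c, a)]; first by move=> u; rewrite inE => /eqP ->.
  by rewrite big_seq1 /= e mulrC.
have [[s ss s1]|J1] := pselect (J 1).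
  exists (size s), (fun j => (nth (0, 0) s j).2).
  have okj j : I' (nth (0, 0) s j).1 /\ I (nth (0, 0) s j).2.
    have [js|js] := ltnP j (size s); first exact/ss/mem_nth.
    by rewrite nth_default//=; split; [exact: (is_submod0 sI') | exact: (is_submod0 sI)].
  have /choice[lam lamP] j : exists l : R -> R, forall x, I x -> (nth (0, 0) s j).1 * x = b * l x.
    have /choice[l lP] x : exists y : R, I x -> (nth (0, 0) s j).1 * x = b * y.
      have [Ix|nIx] := pselect (I x); last by exists 0.
      by have [y e] := (okj j).1 x Ix; exists y.
    by exists l.
  have b1 : \sum_(j < size s) (nth (0, 0) s j).1 * (nth (0, 0) s j).2 = b.
    by rewrite -[RHS]mul1r s1 (big_nth (0, 0)) big_mkord.
  exists lam; split=> [j|j r x y Ix Iy||x Ix]; first exact: (okj j).2.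
  - apply: (mulfI b0); rewrite -lamP; last exact: (is_submodZD sI).
    rewrite /GRing.scale/= !mulrDr [b * (_ * _)]mulrCA -!lamP//; ring.
  - apply: (mulfI b0); rewrite mulr1 -[RHS]b1 mulr_sumr; apply: eq_bigr => j _.
    by rewrite lamP//; exact: (okj j).2.
  - apply: (mulfI b0); rewrite mulr_sumr -[in LHS]b1 mulr_suml; apply: eq_bigr => j _.
    by rewrite mulrA -lamP// mulrAC.
(* If [J] is proper, [prime_colon] with [S = 1 + J] gives a prime [P = (b R : r)]. It contains [b],
   so it is maximal, and then it contains [J]. This forces [r I'] into [b I'], so [r] is a multiple
   of [b] by integrality, and [1] lies in [P]. *)
exfalso; pose F : set R^o := [set x | exists y : R, x = b * y].
have sF : is_submod F.
  split=> [|r _ _ [y ->] [z ->]]; first by exists 0; rewrite mulr0.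
  by exists (r * y + z); rewrite /GRing.scale/=; ring.
pose S : set R := [set x | J (1 - x)].
have [||s Js [y e]|r /=] := @prime_colon R dedekind_noetherian R^o F S 1 sF.
- by rewrite /S/= subrr; exact: (is_submod0 sJ).
- move=> x y Sx Sy; rewrite /S/=.
  have -> : 1 - x * y = y *: (1 - x : R^o) + (1 - y) by rewrite /GRing.scale/=; ring.
  exact: is_submodZD.
- apply: J1; have -> : 1 = y *: (b : R^o) + (1 - s).
    by move: e; rewrite /GRing.scale/= mulr1 => ->; ring.
  by apply: is_submodZD => //; apply: (IJ b b b).
rewrite /GRing.scale/= mulr1 => -[Sr Fr].
pose P : set R^o := [set x | F (x * r)].
have P1 : ~ P 1 by apply: (Sr 1); rewrite /S/= subrr; exact: (is_submod0 sJ).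
have prP : prime_ideal P.
  split=> //; split=> [|c x y Px Py]; rewrite /P/=; first by rewrite mul0r; exact: (is_submod0 sF).
  by rewrite /GRing.scale/= mulrDl -mulrA; exact: (is_submodZD sF).
have Pb : P b by exists r.
have maxP := prime_maximal prP Pb b0.
have JP z : J z -> P z.
  move=> Jz; apply: contrapT => /maxP[y]; apply: Sr.
  by rewrite /S/= opprB addrC subrK; apply: (is_submodZ sJ y).
have I'q x : I' x -> exists2 y : R, I' y & r * x = b * y.
  move=> Ix; have /JP[y] : J x by apply: (IJ x b) => //; rewrite mulrC.
  rewrite mulrC => e; exists y => // a Ia.
  have [z xz] := Ix a Ia.
  have /JP[t zt] : J z by apply: (IJ x a).
  exists t; apply: (mulfI b0); rewrite mulrA -e -mulrA xz -zt; ring.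
have [u ru] := integral_quotient sI' I'b b0 b0 I'q.
by apply: P1; exists u; rewrite mul1r ru mulrC.
Qed.

End Dedekind.

(** * Submodules of [{poly R}] through leading coefficients *)

Section FreeSubmodules.
Variable R : idomainType.
Hypothesis noethR : noetherian R.

Section Lead.
Variables (L : set {poly R}) (sL : is_submod L).

(** A copy of the quotient of the part of [L] of degree at most [n] by the part of degree less than
    [n]. *)
Definition lead_ideal n : set R^o :=
  [set a | exists2 p, L p /\ (size p <= n.+1)%N & p`_n = a].

Lemma is_submod_lead_ideal n : is_submod (lead_ideal n).
Proof.
split=> [|a _ _ [p [Lp pn] <-] [q [Lq qn] <-]].
  by exists 0; rewrite ?coef0// size_poly0; split=> //; exact: is_submod0.
exists (a *: p + q); last by rewrite coefD coefZ.
split; first exact: is_submodZD.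
apply: leq_trans (size_polyD _ _) _; rewrite geq_max qn andbT.
exact: leq_trans (size_scale_leq _ _) pn.
Qed.

Lemma size_sub_lead n (p q : {poly R}) : (size p <= n.+1)%N -> (size q <= n.+1)%N ->
  q`_n = p`_n -> (size (p - q)%R <= n)%N.
Proof.
move=> pn qn qp; apply/leq_sizeP => j; rewrite leq_eqVlt => /predU1P[<-|nj].
  by rewrite coefB qp subrr.
by rewrite coefB !nth_default ?subrr//; [exact: leq_trans qn nj | exact: leq_trans pn nj].
Qed.

Lemma ctbl_gen_sub_poly : ctbl_gen L.
Proof.
have /choice[g gP] n : exists g : nat -> {poly R}, (forall j, L (g j)) /\
    forall p : {poly R}, L p -> (size p <= n.+1)%N -> exists q, (size (p - ev g q)%R <= n)%N.
  have [N [a [Ia aI]]] := ideal_fin_gen noethR (is_submod_lead_ideal n).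
  have /choice[g gP] j : exists p : {poly R}, [/\ L p, (size p <= n.+1)%N & p`_n = a j].
    by have [p [? ?] ?] := Ia j; exists p.
  exists g; split=> [j|p Lp pn]; first by case: (gP j).
  have [|q _ e] := aI p`_n; first by exists p.
  exists q; apply: size_sub_lead => //.
    apply: (leq_trans (size_sum _ _ _)); apply/bigmax_leqP => j _.
    by apply: leq_trans (size_scale_leq _ _) _; case: (gP j).
  rewrite e /ev coef_sum; apply: eq_bigr => j _.
  by rewrite coefZ; have [_ _ ->] := gP j.
(* One sequence enumerates the generators of all degrees through codes of pairs; a number that codes
   no pair gives 0. *)
pose c k := if unpickle k is Some u then g u.1 u.2 else 0.
have cg n j : range (ev c) (g n j).
  by exists 'X^(pickle (n, j)); rewrite // evX /c pickleK.
have sc := is_submod_range_ev c.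
exists c => [k|p Lp].
  by rewrite /c; case: unpickle => [u|]; [case: (gP u.1) | exact: is_submod0].
suff [q _ <-] : range (ev c) p by exists q.
move: {2}(size p) (leqnn (size p)) => n; elim: n p Lp => [|n IHn] p Lp pn.
  by move: pn; rewrite leqn0 size_poly_eq0 => /eqP ->; exact: is_submod0.
have [Lg /(_ p Lp pn)[q qn]] := gP n.
rewrite -[p](subrK (ev (g n) q)); apply: is_submodD => //.
  by apply: IHn => //; apply: is_submodB => //; exact: ev_in.
by apply: ev_in.
Qed.

End Lead.

Lemma ctbl_gen_sub (X : lmodType R) (A B : set X) :
  is_submod A -> ctbl_gen B -> A `<=` B -> ctbl_gen A.
Proof.
move=> sA [b Bb gb] AB; have [c cA cg] := ctbl_gen_sub_poly (is_submod_preimage (ev b) sA).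
exists (ev b \o c) => [i|x Ax]; first exact: cA.
have [p e] := gb x (AB _ Ax); have [|q pq] := cg p; first by rewrite /preimage/= -e.
by exists q; rewrite e pq linear_ev.
Qed.

(** Generators of the kernel at even indices are interleaved with lifts of generators of the image
    at odd indices. *)
Lemma ctbl_gen_ext (X V : lmodType R) (B : set X) (psi : X -> V) :
  is_submod B -> lin_on B psi -> ctbl_gen [set x | B x /\ psi x = 0] ->
  ctbl_gen (psi @` B) -> ctbl_gen B.
Proof.
move=> sB lB [k Bk kg] [h Bh hg].
have /choice[b bP] i : exists x, B x /\ psi x = h i by have [x Bx e] := Bh i; exists x.
pose c i := if odd i then b i./2 else k i./2.
have Bc i : B (c i) by rewrite /c; case: odd; [case: (bP i./2) | case: (Bk i./2)].
exists c => // x Bx; suff [p _ <-] : range (ev c) x by exists p.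
have sc := is_submod_range_ev c.
have [|p e] := hg (psi x); first by exists x.
have Bb q : B (ev b q) by apply: ev_in => // i; case: (bP i).
have [|q eq] := kg (x - ev b p).
  split; first exact: is_submodB.
  rewrite (lin_onB sB lB)// (lin_on_ev sB lB); last by move=> i; case: (bP i).
  by rewrite e; apply/eqP; rewrite subr_eq0; apply/eqP/eq_ev => i /=; case: (bP i).
rewrite -[x](subrK (ev b p)) eq; apply: is_submodD => //; apply: ev_in => // i.
  by exists 'X^(i.*2); rewrite // evX /c odd_double doubleK.
by exists 'X^(i.*2.+1); rewrite // evX /c /= odd_double /= uphalf_double.
Qed.

End FreeSubmodules.

(** * Projectivity of submodules of [{poly R}] *)

Section Projective.
Variable R : idomainType.
Hypothesis hR : dedekind_domain R.
Variables (L : set {poly R}) (sL : is_submod L).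
Variables (V E : lmodType R) (u : {linear {poly R} -> V}) (w : {linear E -> V}).
Hypothesis uw : forall p, L p -> exists e, w e = u p.

(** [tau] is a linear section of the leading coefficient map and [eps] lifts [u \o tau] along [w]:
    both are prescribed on the [a j] of a dual basis and combined by its functionals. The zero ideal
    is treated apart, since [ideal_dual] starts from a nonzero element. *)
Lemma lead_lift n : exists (tau : R^o -> {poly R}) (eps : R^o -> E),
  [/\ lin_on (lead_ideal L n) tau, lin_on (lead_ideal L n) eps &
      forall x, lead_ideal L n x ->
        [/\ L (tau x), (size (tau x) <= n.+1)%N, (tau x)`_n = x & w (eps x) = u (tau x)]].
Proof.
have sI := is_submod_lead_ideal sL n.
have [[b Ib b0]|I0] := pselect (exists2 b, lead_ideal L n b & b != 0); last first.
  exists (fun=> 0), (fun=> 0); split=> [a x y _ _|a x y _ _|x Ix]; rewrite ?scaler0 ?addr0//.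
  have -> : x = 0 by apply: contrapT => /eqP x0; apply: I0; exists x.
  by rewrite size_poly0 coef0 !linear0; split=> //; exact: is_submod0.
have [N [a [lam [Ia llam _ aI]]]] := ideal_dual hR sI Ib b0.
have /choice[g gP] j : exists p : {poly R} * E,
    [/\ L p.1, (size p.1 <= n.+1)%N, p.1`_n = a j & w p.2 = u p.1].
  have [p [Lp pn] e] := Ia j; have [z ze] := uw Lp; by exists (p, z).
have lin (Z : lmodType R) (z : nat -> Z) :
    lin_on (lead_ideal L n) (fun x => \sum_(j < N) lam j x *: z j).
  move=> r x y Ix Iy; rewrite scaler_sumr -big_split; apply: eq_bigr => j _ /=.
  by rewrite (llam j)// scalerDl scalerA.
exists (fun x => \sum_(j < N) lam j x *: (g j).1),
       (fun x => \sum_(j < N) lam j x *: (g j).2).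
split; [exact: (lin _ (fun j => (g j).1)) | exact: (lin _ (fun j => (g j).2)) |] => x Ix; split.
- by apply: is_submod_sum => // j _; apply: is_submodZ => //; case: (gP j).
- apply: (leq_trans (size_sum _ _ _)); apply/bigmax_leqP => j _.
  by apply: leq_trans (size_scale_leq _ _) _; case: (gP j).
- rewrite coef_sum [RHS](aI x Ix); apply: eq_bigr => j _; rewrite coefZ.
  by have [_ _ -> _] := gP j.
- rewrite !linear_sum; apply: eq_bigr => j _; rewrite !linearZ /=.
  by have [_ _ _ ->] := gP j.
Qed.

(** [L] is the direct sum of the images of the sections [tau] over all degrees; [phi] lifts the top
    component by [eps] and recurses on the remainder. *)
Lemma sub_poly_projective : exists2 phi : {poly R} -> E, lin_on L phi &
  forall p, L p -> w (phi p) = u p.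
Proof.
have /choice[te teP] n : exists te : (R^o -> {poly R}) * (R^o -> E),
  [/\ lin_on (lead_ideal L n) te.1, lin_on (lead_ideal L n) te.2 &
      forall x, lead_ideal L n x -> [/\ L (te.1 x), (size (te.1 x) <= n.+1)%N,
        (te.1 x)`_n = x & w (te.2 x) = u (te.1 x)]].
  by have [t [e ?]] := lead_lift n; exists (t, e).
pose phi := fix phi n (p : {poly R}) : E :=
  if n is m.+1 then (te m).2 p`_m + phi m (p - (te m).1 p`_m) else 0.
pose Ln n := [set p : {poly R} | L p /\ (size p <= n)%N].
have sLn n : is_submod (Ln n).
  split=> [|a p q [Lp pn] [Lq qn]]; first by split; [exact: is_submod0 | rewrite size_poly0].
  split; first exact: is_submodZD.
  apply: leq_trans (size_polyD _ _) _; rewrite geq_max qn andbT.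
  exact: leq_trans (size_scale_leq _ _) pn.
have leadLn n p : Ln n.+1 p -> lead_ideal L n p`_n by move=> ?; exists p.
have redLn n p : Ln n.+1 p -> Ln n (p - (te n).1 p`_n).
  move=> Lp; have [_ _ /(_ _ (leadLn _ _ Lp))[Lt tn tp _]] := teP n; case: Lp => Lp pn.
  by split; [exact: is_submodB | exact: size_sub_lead].
have phiP n : lin_on (Ln n) (phi n) /\ forall p, Ln n p -> w (phi n p) = u p.
  elim: n => [|n [IHl IHw]].
    split=> [a p q _ _|p [_]]; first by rewrite scaler0 addr0.
    by rewrite leqn0 size_poly_eq0 => /eqP ->; rewrite !linear0.
  have [lt le teq] := teP n; split=> [a p q Lp Lq|p Lp] /=; last first.
    rewrite linearD /= (IHw _ (redLn _ _ Lp)) linearB /=.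
    by have [_ _ _ ->] := teq _ (leadLn _ _ Lp); rewrite addrC subrK.
  rewrite coefD coefZ -[a * _]/(a *: (p`_n : R^o)).
  rewrite (le _ _ _ (leadLn _ _ Lp) (leadLn _ _ Lq)) (lt _ _ _ (leadLn _ _ Lp) (leadLn _ _ Lq)).
  rewrite opprD addrACA -scalerBr IHl; [|exact: redLn..].
  by rewrite scalerDr addrACA.
(* Raising the degree bound does not change the value, so polynomials of different sizes can be
   compared at a common bound. *)
have phiS n m p : Ln n p -> phi (m + n)%N p = phi n p.
  elim: m => // m IHm Lp; rewrite addSn /= nth_default; last first.
    by case: Lp => _ /leq_trans; apply; exact: leq_addl.
  have [lt le _] := teP (m + n)%N; have s := is_submod_lead_ideal sL (m + n).
  by rewrite (lin_on0 s lt) (lin_on0 s le) subr0 add0r IHm.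
have phiE n p : Ln n p -> phi n p = phi (size p) p.
  by move=> [Lp pn]; rewrite -(subnK pn) phiS.
exists (fun p : {poly R} => phi (size p) p) => [a p q Lp Lq|p Lp]; last by apply: (phiP _).2.
pose n := maxn (size p) (size q).
have Lnp : Ln n p by split; rewrite // leq_maxl.
have Lnq : Ln n q by split; rewrite // leq_maxr.
rewrite -(phiE n p)// -(phiE n q)// -(phiE n); last exact: (is_submodZD (sLn n)).
exact: (phiP n).1.
Qed.

End Projective.

(** * Ext^1 and the extension of maps *)

Section ExtensionLemmas.
Variable R : comNzRingType.
Implicit Types X U V D : lmodType R.

(** [S] is a complement of the image of [D], and [f e] is the component of [e] in [D]. *)
Lemma extension_split U D (E : extension U D) (S : set (ext_mod E)) : is_submod S ->
  (forall e, S e -> ext_out E e = 0 -> e = 0) ->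
  (forall x, exists2 e, S e & ext_out E e = x) ->
  extension_equiv E (split_extension U D).
Proof.
move=> sS S0 SU.
have /choice[f fP] e : exists d, S (e - ext_in E d).
  have [s Ss se] := SU (ext_out E e).
  have [d de] : exists d, ext_in E d = e - s.
    by apply/ext_exact; rewrite linearB se /= subrr.
  by exists d; rewrite de subKr.
have out_in d : ext_out E (ext_in E d) = 0 by apply/ext_exact; exists d.
have fE e d : S (e - ext_in E d) -> f e = d.
  move=> Sd; apply: (@ext_in_inj _ _ _ E); apply/eqP; rewrite -subr_eq0.
  apply/eqP/S0; last by rewrite linearB !out_in subrr.
  have -> : ext_in E (f e) - ext_in E d = (e - ext_in E d) - (e - ext_in E (f e)).
    by rewrite opprB [RHS]addrC addrA subrK.
  exact: is_submodB.
have lf : linear (fun e => (f e, ext_out E e) : D * U).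
  move=> a x y; congr pair; last by rewrite linearP.
  apply: fE; rewrite linearP opprD addrACA -scalerBr; exact: is_submodZD.
pose F : {linear ext_mod E -> (D * U)%type} :=
  HB.pack (fun e => (f e, ext_out E e) : D * U)
    (GRing.isLinear.Build R _ _ *:%R (fun e => (f e, ext_out E e) : D * U) lf).
exists F => [d|e] //=; congr pair => //.
by apply: fE; rewrite subrr; exact: is_submod0.
Qed.

Lemma extension_retract U D (E : extension U D) : Ext1_vanishes U D ->
  exists r : {linear ext_mod E -> D}, forall d, r (ext_in E d) = d.
Proof.
move=> /(_ E)[f f_in _].
have [r rE] : exists r : {linear ext_mod E -> D}, r =1 fst \o f.
  by apply: lin_on_linear => a x y _ _ /=; rewrite linearP.
by exists r => d; rewrite rE /= f_in.
Qed.

(* Push out [0 -> ker -> {poly R} -> U -> 0] along [f : ker -> D]. *)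
Lemma Ext1_extends U D (g : nat -> U) : (forall x, exists p, x = ev g p) ->
  Ext1_vanishes U D -> extends D (ker (ev g)) setT.
Proof.
move=> gU UD f lf; have sK := is_submod_ker (ev g).
(* The quotient by [W] identifies [(f p, 0)] with [(0, p)] for [p] in the kernel, so a retraction
   onto [D], restricted to [{poly R}], extends [f]. *)
pose W : set (D * {poly R}) := [set z | ker (ev g) z.2 /\ z.1 = - f z.2].
have sW : is_submod W.
  split=> [|a [d p] [d' p'] [/= Kp ->] [/= Kp' ->]].
    by split; rewrite /= ?(lin_on0 sK lf) ?oppr0//; exact: is_submod0.
  split; first exact: is_submodZD.
  by rewrite /= lf// opprD scalerN.
pose pr := quotmap (mk_submod sW).
have prW z : pr z = 0 <-> W z.
  rewrite -(linear0 pr); split=> [/quotmap_eq|Wz]; rewrite ?subr0 ?mk_submodE//.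
  by apply/quotmap_eq; rewrite subr0; apply/mk_submodE.
have /choice[o oP] (e : quotmod (mk_submod sW)) : exists x, forall z, pr z = e -> ev g z.2 = x.
  have [z ->] := quotmap_surj e; exists (ev g z.2) => z' /quotmap_eq/mk_submodE[+ _].
  by rewrite /ker /= linearB /= => /eqP; rewrite subr_eq0 => /eqP.
have oE z : o (pr z) = ev g z.2 by rewrite -(oP _ z).
have lo : lin_on setT o.
  move=> a e e' _ _; have [z ->] := quotmap_surj e; have [z' ->] := quotmap_surj e'.
  by rewrite -/pr -linearP !oE /= linearP.
have [out outE] := lin_on_linear lo.
have [inn innE] : exists i : {linear D -> quotmod (mk_submod sW)}, i =1 fun d => pr (d, 0).
  apply: lin_on_linear => a d d' _ _; rewrite -linearP; congr pr.
  by congr pair; rewrite /= scaler0 addr0.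
have inn_inj : injective inn.
  move=> d d'; rewrite !innE => /quotmap_eq/mk_submodE[_ /=].
  by rewrite subrr (lin_on0 sK lf) oppr0 => /eqP; rewrite subr_eq0 => /eqP.
have out_surj x : exists e, out e = x.
  by have [p ->] := gU x; exists (pr (0, p)); rewrite outE oE.
have exact e : out e = 0 <-> exists d, inn d = e.
  split=> [|[d <-]]; last by rewrite outE innE oE linear0.
  have [[d p] ->] := quotmap_surj e; rewrite outE -/pr oE /= => Kp.
  exists (d + f p); rewrite innE; apply/quotmap_eq/mk_submodE.
  rewrite /W/=; split; first by apply: is_submodB => //; exact: is_submod0.
  by rewrite addrC addKr sub0r (lin_onN sK lf)// opprK.
have [r rE] := extension_retract (Extension inn_inj out_surj exact) UD.
exists (fun p => r (pr (0, p))) => [a p q _ _|p Kp].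
  rewrite -linearP -linearP; congr (r (pr _)).
  by congr pair; rewrite /= scaler0 addr0.
rewrite -[RHS]rE /= innE; congr (r _); apply/quotmap_eq/mk_submodE.
by split; rewrite /= ?subr0 ?sub0r.
Qed.

(** [B / A] is presented by [h]. With lifts [b i] of the [h i], the map [f \o ev b] extends from
    [ker (ev h)] to some [H], and [H p + f (x - ev b p)] does not depend on the choice of [p] with
    [psi x = ev h p]. *)
Lemma extends_quot X V D (A B : set X) (psi : X -> V) (h : nat -> V) :
  is_submod A -> is_submod B -> lin_on B psi -> A `<=` B ->
  (forall x, B x -> psi x = 0 <-> A x) ->
  (forall i, exists2 b, B b & psi b = h i) ->
  (forall x, B x -> exists p, psi x = ev h p) ->
  extends D (ker (ev h)) setT -> extends D A B.
Proof.
move=> sA sB lpsi AB psiA psi_h psiB hD f lf.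
have /choice[b bP] i : exists b, B b /\ psi b = h i by have [b] := psi_h i; exists b.
have Bb i : B (b i) by case: (bP i).
have psi_ev p : psi (ev b p) = ev h p.
  by rewrite (lin_on_ev sB lpsi)//; apply: eq_ev => i /=; case: (bP i).
have Bev p : B (ev b p) by exact: ev_in.
have Kev p : ker (ev h) p -> A (ev b p).
  by move=> Kp; apply/(psiA _ (Bev p)); rewrite psi_ev.
have [|H lH HK] := hD (fun p => f (ev b p)).
  by move=> a p q Kp Kq; rewrite linearP lf//; exact: Kev.
have /choice[s sP] x : exists p, B x -> psi x = ev h p.
  by have [/psiB[p ?]|nB] := pselect (B x); [exists p | exists 0].
have Asub x p : B x -> psi x = ev h p -> A (x - ev b p).
  move=> Bx e; apply/psiA; first exact: is_submodB.
  by rewrite (lin_onB sB lpsi)// e psi_ev subrr.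
have HE x p : B x -> psi x = ev h p ->
    H (s x) + f (x - ev b (s x)) = H p + f (x - ev b p).
  move=> Bx e; have es := sP x Bx.
  have Kd : ker (ev h) (s x - p) by rewrite /ker/= linearB /= -es e subrr.
  have -> : x - ev b p = (x - ev b (s x)) + ev b (s x - p).
    by rewrite linearB /= addrA subrK.
  rewrite [f (_ - _ + _)](lin_onD lf); [|exact: (Asub _ _ Bx es)|exact: (Kev _ Kd)].
  rewrite -HK// (lin_onB (is_submodT _) lH)//.
  by rewrite [X in _ = _ + X]addrC addrA [X in _ = X + _]addrC subrK.
exists (fun x => H (s x) + f (x - ev b (s x))) => [a x y Bx By|x Ax].
  rewrite (HE _ (a *: s x + s y)); last 2 first.
  - exact: is_submodZD.
  - by rewrite lpsi// linearP /= -!sP.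
  rewrite lH// linearP /= opprD addrACA -scalerBr lf; [|apply: Asub..] => //; try exact: sP.
  by rewrite scalerDr addrACA.
rewrite (HE _ 0); [|exact: AB|]; last by rewrite linear0; apply/psiA => //; exact: AB.
by rewrite linear0 subr0 (lin_on0 (is_submodT _) lH) add0r.
Qed.

(** The inverse of [ext_in] on its image extends to a retraction of the middle module, whose kernel
    is the required complement. *)
Lemma Ext1_vanishes_gen U D (g : nat -> U) : (forall x, exists p, x = ev g p) ->
  extends D (ker (ev g)) setT -> Ext1_vanishes U D.
Proof.
move=> gU gD E.
have sA : is_submod (ker (ext_out E)) by exact: is_submod_ker.
have /choice[i iP] e : exists d, ext_out E e = 0 -> ext_in E d = e.
  have [/ext_exact[d]|ne] := pselect (ext_out E e = 0); first by exists d.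
  by exists 0.
have out_in d : ext_out E (ext_in E d) = 0 by apply/ext_exact; exists d.
have : extends D (ker (ext_out E)) setT.
  apply: (@extends_quot _ U D _ _ (ext_out E) g) => //.
  - exact: lin_onW.
  - by move=> j; have [e <-] := ext_out_surj E (g j); exists e.
case/(_ i) => [a x y /= Kx Ky|r lr rE].
  by apply: (@ext_in_inj _ _ _ E); rewrite linearP !iP// linearP Kx Ky scaler0 addr0.
have sS : is_submod (ker r).
  have [r' r'E] := lin_on_linear lr; rewrite (_ : ker r = ker r'); first exact: is_submod_ker.
  by apply/seteqP; split=> x; rewrite /ker /= r'E.
apply: (extension_split sS) => [e re /[dup] oe /iP <-|x].
  by rewrite -(rE e oe) re linear0.
have [e <-] := ext_out_surj E x; exists (e - ext_in E (r e)); last by rewrite linearB out_in subr0.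
rewrite /ker /= (lin_onB (is_submodT _) lr)// [r (ext_in _ _)]rE; last exact: out_in.
by apply/eqP; rewrite subr_eq0; apply/eqP/(@ext_in_inj _ _ _ E); rewrite iP.
Qed.

(* Eklof's lemma: Zorn on the graphs of partial extensions of [f]. *)
Lemma extends_chain X D (FF : set (set X)) (A0 : set X) :
  FF A0 -> (forall A, FF A -> is_submod A) ->
  (forall CC : set (set X), CC `<=` FF -> CC !=set0 -> total_on CC subset ->
    FF (\bigcup_(A in CC) A)) ->
  (forall A, FF A -> A = setT \/ exists B, [/\ FF B, A `<=` B, ~ B `<=` A & extends D A B]) ->
  extends D A0 setT.
Proof.
move=> F0 Fs Fchain Fstep f lf.
pose G0 : set (X * D) := [set z | A0 z.1 /\ z.2 = f z.1].
pose dom (G : set (X * D)) : set X := [set x | exists d, G (x, d)].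
have s0 := Fs _ F0.
pose Q (G : set (X * D)) := [/\ is_submod G, (forall d, G (0, d) -> d = 0) & FF (dom G)].
(* Zorn's lemma also asks for the union of the empty chain; adjoining [G0] makes the empty set
   admissible. *)
pose P (G : set (X * D)) := Q (G `|` G0).
have Q0 : Q G0.
  split=> [|d [_ /=]|]; last 1 first.
  - suff -> : dom G0 = A0 by [].
    by apply/seteqP; split=> [x [d []]|x Ax] //; exists (f x).
  - split=> [|a [x d] [y e] [/= Ax ->] [/= Ay ->]].
      by split; rewrite /= ?(lin_on0 s0 lf)//; exact: is_submod0.
    by split; rewrite /= ?lf//; exact: is_submodZD.
  - by rewrite (lin_on0 s0 lf).
have [CC CP Ctot|G [PG Gmax]] := @Zorn_bigcup _ P.
  have [C0|] := pselect (CC = set0); first by rewrite C0 /P bigcup_set0 set0U.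
    move=> /eqP/set0P[G1 CG1].
    pose CU := [set G `|` G0 | G in CC].
    have -> : P (\bigcup_(X in CC) X) = Q (\bigcup_(X in CU) X).
      congr Q; apply/seteqP; split=> [z [[G CG Gz]|Gz]|z [_ [G CG <-] [Gz|Gz]]].
      - by exists (G `|` G0); [exists G | left].
      - by exists (G1 `|` G0); [exists G1 | right].
      - by left; exists G.
      - by right.
    have CUQ G : CU G -> Q G by move=> [H CH <-]; exact: CP.
    have CUtot G H : CU G -> CU H -> G `<=` H \/ H `<=` G.
      move=> [G' CG' <-] [H' CH' <-]; have [GH|HG] := Ctot _ _ CG' CH'; [left|right];
        exact: setSU.
    have CU1 : CU (G1 `|` G0) by exists G1.
    split.
    - split=> [|a x y [G CG Gx] [H CH Hy]].
        by exists (G1 `|` G0) => //; have [+ _ _] := CUQ _ CU1; exact: is_submod0.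
      have [GH|HG] := CUtot _ _ CG CH.
        by exists H => //; have [sH _ _] := CUQ _ CH; apply: is_submodZD => //; exact: GH.
      by exists G => //; have [sG _ _] := CUQ _ CG; apply: is_submodZD => //; exact: HG.
    - by move=> d [G CG]; have [_ + _] := CUQ _ CG; apply.
    - have -> : dom (\bigcup_(X in CU) X) = \bigcup_(A in dom @` CU) A.
        apply/seteqP; split=> [x [d [G CG Gx]]|x [_ [G CG <-] [d Gx]]].
          by exists (dom G); [exists G | exists d].
        by exists d, G.
      apply: Fchain => [_ [G CG <-]||_ _ [G CG <-] [H CH <-]].
      + by have [] := CUQ _ CG.
      + by exists (dom (G1 `|` G0)), (G1 `|` G0).
      + have [GH|HG] := CUtot _ _ CG CH; [left|right] => x [d Gx]; exists d;
          [exact: GH | exact: HG].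
have [sG G00 FG] := PG; set G' := G `|` G0 in PG sG G00 FG.
have /choice[g gP] x : exists d, dom G' x -> G' (x, d).
  by have [[d Gd]|nG] := pselect (dom G' x); [exists d | exists 0].
have gE x d : G' (x, d) -> g x = d.
  move=> Gd; have Gg : G' (x, g x) by apply: gP; exists d.
  apply/eqP; rewrite -subr_eq0; apply/eqP/G00.
  have -> : (0, g x - d) = (x, g x) - (x, d) by congr pair; rewrite /= subrr.
  exact: is_submodB.
have lg : lin_on (dom G') g.
  move=> a x y dx dy; apply: gE.
  exact: (is_submodZD sG a (gP _ dx) (gP _ dy)).
have gf x : A0 x -> g x = f x by move=> Ax; apply: gE; right.
have [GT|[B [FB GB BG /(_ g lg)[h lh hg]]]] := Fstep _ FG; first by exists g => //; rewrite -GT.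
exfalso; have sB := Fs _ FB; pose H : set (X * D) := [set z | B z.1 /\ z.2 = h z.1].
have G'H : G' `<=` H.
  move=> [x d] Gx; have dx : dom G' x by exists d.
  by split; [exact: GB | rewrite /= hg// (gE x d)].
have [|] := Gmax H.
- split; first by apply: subset_trans G'H; exact: subsetUl.
  move=> HG; apply: BG => x Bx; exists (h x); left; exact: HG.
- rewrite /P setUidl; last by apply: subset_trans G'H; exact: subsetUr.
  split=> [|d [_ /= ->]|].
  + split=> [|a [x d] [y e] [/= Ax ->] [/= Ay ->]].
      by split; rewrite /= ?(lin_on0 sB lh)//; exact: is_submod0.
    by split; rewrite /= ?lh//; exact: is_submodZD.
  + exact: (lin_on0 sB lh).
  + suff -> : dom H = B by [].
    by apply/seteqP; split=> [x [d []]|x Ax] //; exists (h x).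
Qed.

End ExtensionLemmas.

(** * Very flat sequences and contraadjusted modules *)

Section VeryFlatSequences.
Variable R : comNzRingType.
Implicit Types M U D : lmodType R.

(* [very_flat_seq c] : the submodule generated by the sequence [c] is very flat. *)
Definition very_flat_seq M (c : nat -> M) : Prop :=
  forall D : lmodType R, contraadjusted D -> extends D (ker (ev c)) setT.

Lemma very_flat_gen U (g : nat -> U) : (forall x, exists p, x = ev g p) ->
  very_flat U <-> very_flat_seq g.
Proof.
move=> gU; split=> vU D cD; first exact: (Ext1_extends gU (vU D cD)).
exact: (Ext1_vanishes_gen gU (vU D cD)).
Qed.

Lemma very_flat_submod M (N : submodClosed M) (c : nat -> M) :
  (forall i, c i \in N) -> (forall x, x \in N -> exists p, x = ev c p) ->
  very_flat (submod N) <-> very_flat_seq c.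
Proof.
move=> Nc gN; pose d i : submod N := Sub (c i) (Nc i).
have vd p : val (ev d p) = ev c p by rewrite linear_ev; exact: eq_ev.
have -> : very_flat_seq c <-> very_flat_seq d.
  suff e : ker (ev c) = ker (ev d) by rewrite /very_flat_seq e.
  apply/seteqP; split=> p; rewrite /ker /= -vd; last by move=> ->; exact: linear0.
  by move=> e; exact: val_inj.
apply: very_flat_gen => x; have [p e] := gN _ (valP x).
by exists p; apply: val_inj; rewrite vd.
Qed.

(** A splitting over [R[r^-1]] amounts to lifts [e' n] of the fractions [1 / r ^ n] with
    [e' n = r *: e' n.+1]. Arbitrary lifts [e n] are corrected by a solution of
    [x n = d n + r *: x n.+1] in [D]. *)
Lemma contraadjusted_regular D :
  (forall (r : R) (d : D), exists e, r *: d = r *: (r *: e)) -> contraadjusted D.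
Proof.
move=> reg r E.
have /choice[e eP] n := ext_out_surj E (loc_frac r 1 n).
have /choice[d dP] n : exists d, ext_in E d = r *: e n.+1 - e n.
  apply/ext_exact; rewrite linearB linearZ /= !eP.
  apply/eqP; rewrite subr_eq0; apply/eqP; rewrite [LHS]loc_scaleE.
  by apply/loc_frac_eq; exists 0%N; rewrite exprS; ring.
have /choice[w wP] (d : D) := reg r d.
(* [d n] is the sum of [d n - r *: w (d n)], which [r] kills, and an element of [r D], where [w]
   permits division by [r]. Solving forwards for the part in [r D] gives [z], with an arbitrary
   start. *)
pose z := nat_rect (fun _ => D) 0 (fun n z => w (z - w (d n))).
pose x n := d n - r *: w (d n) + r *: z n.
have xP n : x n = d n + r *: x n.+1.
  have zS : z n.+1 = w (z n - w (d n)) by [].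
  rewrite /x zS 2!scalerDr scalerN -!wP subrr add0r.
  by rewrite scalerBr -addrA [X in _ = _ + X]addrC.
pose e' n := e n + ext_in E (x n).
have e'S n : e' n = r *: e' n.+1.
  rewrite /e' xP linearD linearZ dP /= scalerDr.
  by rewrite addrA [e n + _]addrC subrK.
have e'D n m : e' n = r ^+ m *: e' (n + m)%N.
  elim: m => [|m IHm]; first by rewrite scale1r addn0.
  by rewrite IHm exprSr -scalerA addnS -e'S.
have out_in y : ext_out E (ext_in E y) = 0 by apply/ext_exact; exists y.
have out_e' a n : ext_out E (a *: e' n) = loc_frac r a n.
  by rewrite linearZ linearD out_in addr0 /= eP [LHS]loc_scaleE mulr1.
apply: (@extension_split _ _ _ _ [set y | exists a n, y = a *: e' n]).
- split=> [|c _ _ [a [n ->]] [b [m ->]]]; first by exists 0, 0%N; rewrite scale0r.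
  exists (c * a * r ^+ m + b * r ^+ n), (n + m)%N.
  rewrite {1}(e'D n m) {1}(e'D m n) !scalerA [(m + n)%N]addnC -scalerDl.
  by congr (_ *: _).
- move=> _ [a [n ->]]; rewrite out_e' => /loc_frac_eq[k].
  rewrite mulr0 subr0 expr0 mul1r => h.
  by rewrite (e'D n k) scalerA mulrC h scale0r.
- by move=> y; have [a [n ->]] := loc_fracP y; exists (a *: e' n) => //; exists a, n.
Qed.

Lemma loc_gen (r : R) : forall x : localization r, exists p, x = ev (loc_frac r 1) p.
Proof.
move=> x; have [a [n ->]] := loc_fracP x; exists (a *: 'X^n).
by rewrite linearZ /= evX [RHS]loc_scaleE mulr1.
Qed.

End VeryFlatSequences.

(** * A contraadjusted test module *)

Section TestModule.
Variable R : idomainType.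

(* Semisimple modules are contraadjusted, as each r acts on R / P either as 0
   or invertibly. The test module is the direct sum of the R / P i, realized
   as a quotient of {poly R}. *)
Variables (P : nat -> set R^o) (sP : forall i, is_submod (P i)).
Hypothesis mP : forall i, max_or_unit (P i).

Definition test_ker : set {poly R} := [set f | forall i, P i f`_i].

Lemma is_submod_test_ker : is_submod test_ker.
Proof.
split=> [i|a f g Pf Pg i]; first by rewrite coef0; exact: (is_submod0 (sP i)).
by rewrite coefD coefZ; apply: (is_submodZD (sP i)).
Qed.

Definition test_module : lmodType R := quotmod (mk_submod is_submod_test_ker).

Lemma contraadjusted_test_module : contraadjusted test_module.
Proof.
apply: contraadjusted_regular => r u; have [f ->] := quotmap_surj u.
pose pr : {linear {poly R} -> test_module} := quotmap (mk_submod is_submod_test_ker).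
have prZ a g : a *: pr g = pr (a *: g) by rewrite linearZ.
(* [y i] is an inverse of [r] modulo [P i], or 0 when [r] acts as 0 on that component. *)
have /choice[y yP] i : exists y : R, P i (r * (1 - y * r)).
  have [Pr|/mP[y Py]] := pselect (P i r); last by exists y; exact: (is_submodZ (sP i)).
  by exists 0; rewrite mul0r subr0 mulr1.
exists (pr (\poly_(i < size f) (y i * f`_i))); rewrite -[quotmap _ f]/(pr f).
rewrite [r *: pr (\poly_(_ < _) _)]prZ !prZ; apply/quotmap_eq/mk_submodE => i.
rewrite coefB !coefZ coef_poly; case: ltnP => [_|fi]; last first.
  by rewrite nth_default// !mulr0 subrr; exact: (is_submod0 (sP i)).
have -> : r * f`_i - r * (r * (y i * f`_i)) = f`_i *: (r * (1 - y i * r) : R^o).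
  by rewrite /GRing.scale/=; ring.
exact: (is_submodZ (sP i)).
Qed.

Variables (M : lmodType R) (c : nat -> M) (m : nat).
Hypothesis vc : very_flat_seq c.
Hypothesis kerP : forall f, ev c f = 0 -> forall i, (m <= i)%N -> P i f`_i.
Hypothesis Pker : forall i (a : R), (m <= i)%N -> P i a ->
  exists2 u : {poly R}, (size u <= m)%N & ev c (u + a *: 'X^i) = 0.

(** Applying [theta i] to the coefficients of index at least [m] maps [ker (ev c)] to the test
    module; [d] represents the values on the ['X^j] of an extension to [{poly R}]. At an index [i]
    where the [d j] with [j < m] vanish, evaluating the extension at [u + a *: 'X^i] leaves only [a]
    times an element, so [theta i a] is 0 modulo [P i]. *)
Lemma test_module_obstruction (theta : nat -> R -> R) :
  (forall i, lin_on (P i) (theta i : R^o -> R^o)) ->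
  exists d : nat -> {poly R}, forall i, (m <= i)%N ->
    (forall j, (j < m)%N -> P i (d j)`_i) ->
    forall a : R, P i a -> P i (theta i a).
Proof.
move=> lth; pose pr : {linear {poly R} -> test_module} := quotmap (mk_submod is_submod_test_ker).
pose g (p : {poly R}) := \poly_(i < size p) (if (m <= i)%N then theta i p`_i else 0).
have th0 i : theta i 0 = 0 by exact: (lin_on0 (sP i) (lth i)).
have gE p i : (g p)`_i = if (m <= i)%N then theta i p`_i else 0.
  rewrite coef_poly; case: ltnP => // pi; rewrite nth_default// th0.
  by case: ifP.
have lg : lin_on (ker (ev c)) (fun p => pr (g p)).
  move=> a p q Kp Kq; rewrite -linearP; congr (pr _); apply/polyP => i.
  rewrite coefD coefZ !gE coefD coefZ; case: leqP => [mi|_]; last by rewrite mulr0 addr0.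
  by apply: (lth i); exact: kerP.
have [h lh hg] := vc contraadjusted_test_module lg.
have /choice[d dP] j : exists d, h 'X^j = pr d by exact: quotmap_surj.
exists d => i mi Pd a Pa; have [u um Ku] := Pker mi Pa.
have [h' hE] := lin_on_linear lh.
pose q : {poly R} := \sum_(j < m) u`_j *: d j + a *: d i.
have : pr q = pr (g (u + a *: 'X^i)).
  rewrite /q -hg// -!hE linearD linearZ linear_sum linearD linearZ /= [h' 'X^i]hE dP.
  congr (_ + _).
  rewrite -[u in RHS](coefK) poly_def linear_sum (big_ord_widen m (fun j => h' (u`_j *: 'X^j)) um).
  rewrite [RHS]big_mkcond; apply: eq_bigr => j _.
  case: ltnP => [_|uj]; first by rewrite !linearZ /= hE dP.
  by rewrite nth_default// !scale0r linear0.
move=> /quotmap_eq/mk_submodE/(_ i).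
rewrite coefB gE mi coefD coefZ coefXn eqxx mulr1 [u`_i]nth_default ?add0r;
  last exact: leq_trans um mi.
move=> Ps; have -> : theta i a = (q`_i : R^o) - (q`_i - theta i a) by rewrite subKr.
apply: (is_submodB (sP i)) Ps; rewrite /q coefD coef_sum.
apply: (is_submodD (sP i)); last by rewrite coefZ mulrC; apply: (is_submodZ (sP i)).
apply: (is_submod_sum (sP i)) => j _; rewrite coefZ; apply: (is_submodZ (sP i)).
exact: Pd.
Qed.

End TestModule.

(** * Very flat modules over a Dedekind domain *)

Section DedekindVeryFlat.
Variable R : idomainType.
Hypothesis hR : dedekind_domain R.
Implicit Types M : lmodType R.

(* Over a hereditary ring Ext^2 = 0, so submodules of very flat modules are
   very flat; [phi] below lifts the preimage of the submodule in {poly R}. *)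
Lemma very_flat_sub M (g h : nat -> M) : (forall i, exists p, h i = ev g p) ->
  very_flat_seq g -> very_flat_seq h.
Proof.
move=> /choice[t tP] vg D cD f lf.
have Tp p : ev g (ev t p) = ev h p by rewrite linear_ev; apply: eq_ev => i /=.
have sL := is_submod_preimage (ev g) (is_submod_range_ev h).
have [|phi lphi phiE] := @sub_poly_projective R hR _ sL _ _ (ev g) (ev h).
  by move=> p [q _ e]; exists q.
have LK p : ker (ev g) p -> (ev g @^-1` range (ev h)) p.
  by move=> Kp; exists 0; rewrite ?linear0.
have Kphi p : ker (ev g) p -> ker (ev h) (phi p).
  by move=> Kp; rewrite /ker /= phiE//; exact: LK.
have [|H lH HE] := vg D cD (f \o phi).
  by move=> a p q Kp Kq /=; rewrite lphi ?lf//; [exact: Kphi..|exact: LK|exact: LK].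
have LT p : (ev g @^-1` range (ev h)) (ev t p) by exists p.
have Kd p : ker (ev h) (phi (ev t p) - p) by rewrite /ker /= linearB /= (phiE _ (LT p)) /= Tp subrr.
have sK := is_submod_ker (ev h).
(* [phi] need not be the identity after [ev t], but [phi (ev t p) - p] lies in [ker (ev h)], where
   [f] can be applied to correct the difference. *)
exists (fun p => H (ev t p) - f (phi (ev t p) - p)) => [a p q _ _|p Kp].
  have -> : phi (ev t (a *: p + q)) - (a *: p + q) =
      a *: (phi (ev t p) - p) + (phi (ev t q) - q).
    by rewrite linearP (lphi _ _ _ (LT p) (LT q)) opprD addrACA scalerBr.
  by rewrite linearP lH// (lf _ _ _ (Kd p) (Kd q)) scalerBr opprD addrACA.
have KT : ker (ev g) (ev t p) by rewrite /ker /= Tp.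
rewrite HE//= (lin_onB sK lf)//; first by rewrite subKr.
by rewrite /ker/= phiE ?Tp.
Qed.

(** If every functional of a dual basis mapped [P] into itself, the sum [1] of the [lam j (a j)]
    would lie in [P]. *)
Lemma prime_functional (P : set R^o) (b : R) : prime_ideal P -> P b -> b != 0 ->
  exists2 theta : R -> R, lin_on P (theta : R^o -> R^o) &
    ~ forall a : R, P a -> P (theta a).
Proof.
move=> [sP P1 Pp] Pb b0; have [n [a [lam [Pa llam l1 _]]]] := ideal_dual hR sP Pb b0.
apply: contrapT => h; apply: P1; rewrite -l1; apply: (is_submod_sum sP) => j _.
apply: contrapT => nP; apply: h; exists (lam j) => // /(_ (a j) (Pa j)).
exact: nP.
Qed.

(** A nonzero torsion element has a multiple [y] whose annihilator is a nonzero prime [P], so a copy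
    of [R / P] would be very flat. The obstruction rules this out, with [m = 0] and index 0 as the
    only one with a proper ideal. *)
Lemma very_flat_torsion_free M (g : nat -> M) : very_flat_seq g ->
  forall (a : R) x, range (ev g) x -> a != 0 -> a *: x = 0 -> x = 0.
Proof.
move=> vg b x [p _ xp] b0 bx; apply: contrapT => x0.
have [||s ->|r /= [S1 Sp]] :=
  @prime_colon R (dedekind_noetherian hR) M [set 0] [set 1] x (is_submod_0 M).
- by [].
- by move=> ? ? -> ->; rewrite mulr1.
- by rewrite scale1r.
have {}S1 := S1 1 erefl.
pose y := r *: x; pose c i : M := if i == 0%N then y else 0.
have vc : very_flat_seq c.
  apply: very_flat_sub vg => i; rewrite /c; case: eqP => _; last by exists 0; rewrite linear0.
  by exists (r *: p); rewrite linearZ /= xp.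
have cE (f : {poly R}) : ev c f = f`_0 *: y.
  rewrite (evE _ (leqnSn _)) big_ord_recl big1 ?addr0// => i _.
  by rewrite /c /= scaler0.
pose P : set R^o := [set a | a *: y = 0].
have sP : is_submod P.
  split=> [|a u v Pu Pv]; rewrite /P/= ?scale0r//.
  by rewrite scalerDl -scalerA Pu Pv scaler0 addr0.
have Pb : P b by rewrite /P/= scalerA mulrC -scalerA bx scaler0.
have prP : prime_ideal P by [].
have mP := prime_maximal hR prP Pb b0.
have [th lth []] := prime_functional prP Pb b0.
pose PP i := if i == 0%N then P else setT.
have sPP i : is_submod (PP i) by rewrite /PP; case: eqP.
have mPP i : max_or_unit (PP i) by rewrite /PP; case: eqP => // _ z; exists 0.
have kerPP f : ev c f = 0 -> forall i, (0 <= i)%N -> PP i f`_i.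
  by rewrite cE /PP => fy i _; case: eqP => // ->.
have PPker i (a : R) : (0 <= i)%N -> PP i a ->
    exists2 u : {poly R}, (size u <= 0)%N & ev c (u + a *: 'X^i) = 0.
  move=> _; rewrite /PP => Pa; exists 0; first by rewrite size_poly0.
  rewrite add0r cE coefZ coefXn; move: Pa; case: i => [Pa|i _] /=; first by rewrite mulr1.
  by rewrite mulr0 scale0r.
pose ths i : R -> R := if i == 0%N then th else fun=> 0.
have lths i : lin_on (PP i) (ths i : R^o -> R^o).
  by rewrite /PP /ths; case: eqP => // _ a u v _ _; rewrite scaler0 addr0.
have [d dP] := test_module_obstruction sPP mPP vc kerPP PPker lths.
by move=> a; apply: (dP 0%N).
Qed.

End DedekindVeryFlat.

(** * Countable chains of submodules *)

Section Chains.
Variable R : comNzRingType.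
Implicit Types X D : lmodType R.

(** Eklof's lemma for the [A n] together with [setT], the union of any unbounded subfamily. *)
Lemma extends_nat_chain X D (A : nat -> set X) :
  (forall n, is_submod (A n)) -> (forall n, A n `<=` A n.+1) ->
  (forall x, exists n, A n x) -> (forall n, extends D (A n) (A n.+1)) ->
  extends D (A 0%N) setT.
Proof.
move=> sA AS AT eA.
have Amono m n : (m <= n)%N -> A m `<=` A n.
  by move=> mn; rewrite -(subnK mn); elim: (n - m)%N => // k IHk; exact: subset_trans (AS _).
apply: (@extends_chain R X D (fun B => B = setT \/ exists n, B = A n)).
- by right; exists 0%N.
- by move=> _ [->|[n ->]]; [exact: is_submodT | exact: sA].
- move=> CC CF [B0 CB0] _.
  have [[n nP]|unb] := pselect (exists n, \bigcup_(B in CC) B `<=` A n).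
    have exn : exists n, `[< \bigcup_(B in CC) B `<=` A n >] by exists n; apply/asboolP.
    case: (ex_minnP exn) => {nP exn}n /asboolP nP nmin; right; exists n.
    apply/seteqP; split=> //; case: n nP nmin => [|n] nP nmin.
      have [B0T|[m B0m]] := CF _ CB0; first by move=> x _; exists B0 => //; rewrite B0T.
      by move=> x Ax; exists B0 => //; rewrite B0m; exact: (Amono 0%N m).
    apply: contrapT => h; suff : (n.+1 <= n)%N by rewrite ltnn.
    apply/nmin/asboolP => x [B CB Bx].
    have [BT|[m Bm]] := CF _ CB; first by exfalso; apply: h => y _; exists B; rewrite // BT.
    have [mn|nm] := leqP m n; first by apply: (Amono m n) => //; rewrite -Bm.
    exfalso; apply: h => y Ay; exists B; rewrite // Bm; exact: (Amono n.+1 m).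
  left; apply/seteqP; split=> // x _; have [n An] := AT x; apply: contrapT => nx.
  apply: unb; exists n => y [B CB By]; have [BT|[m Bm]] := CF _ CB.
    by exfalso; apply: nx; exists B; rewrite // BT.
  have [mn|nm] := leqP m n; first by apply: (Amono m n) => //; rewrite -Bm.
  by exfalso; apply: nx; exists B; rewrite // Bm; apply: (Amono n m) => //; exact: ltnW.
- move=> _ [->|[n ->]]; first by left.
  have [AnT|nT] := pselect (A n = setT); [by left | right].
  (* The sequence may be stationary for a while: at the least index [m.+1] whose term is not inside
     [A n], the preceding term equals [A n]. *)
  have exm : exists m, `[< ~ A m `<=` A n >].
    apply: contrapT => h; apply: nT; apply/seteqP; split=> // x _.
    have [m Am] := AT x; apply: contrapT => nx; apply: h; exists m.
    by apply/asboolP => /(_ x Am).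
  case: (ex_minnP exm) => -[|m] /asboolP mP mmin; first by case: mP; exact: Amono.
  have AmE : A m = A n.
    apply/seteqP; split.
      by apply: contrapT => h; have := mmin m; rewrite ltnn => /(_ (asboolT h)).
    by apply: (Amono n m); rewrite leqNgt; apply/negP => mn; apply: mP; exact: Amono.
  exists (A m.+1); split; rewrite -?AmE//; first by right; exists m.+1.
  by rewrite AmE.
Qed.

Lemma ctbl_gen_bigcup X (A : nat -> set X) : is_submod (\bigcup_n A n) ->
  (forall n, ctbl_gen (A n)) -> ctbl_gen (\bigcup_n A n).
Proof.
move=> sA gA.
have /choice[g gP] n : exists g : nat -> X, (forall i, A n (g i)) /\
    forall x, A n x -> exists p, x = ev g p by have [g] := gA n; exists g.
pose c k := if unpickle k is Some u then g u.1 u.2 else 0.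
exists c => [k|x [n _ Ax]].
  rewrite /c; case: unpickle => [u|]; last exact: is_submod0.
  by exists u.1 => //; exact: (gP u.1).1.
have [p ->] := (gP n).2 x Ax; suff [q _ <-] : range (ev c) (ev (g n) p) by exists q.
apply: ev_in => [|i]; first exact: is_submod_range_ev.
by exists 'X^(pickle (n, i)); rewrite // evX /c pickleK.
Qed.

End Chains.

(** * Torsion closures of finitely generated submodules *)

Section FiniteRank.
Variable R : idomainType.
Hypothesis hR : dedekind_domain R.

(** [B / A] only embeds into [V]; its image is countably generated because [R] is noetherian, and
    very flat as a submodule of [V]. *)
Lemma extends_very_flat_quot (X V D : lmodType R) (A B : set X) (psi : X -> V) (g : nat -> V) :
  is_submod A -> is_submod B -> lin_on B psi -> A `<=` B ->
  (forall x, B x -> psi x = 0 <-> A x) -> (forall x, exists p, x = ev g p) ->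
  very_flat V -> contraadjusted D -> extends D A B.
Proof.
move=> sA sB lpsi AB psiA gV vV cD.
have [h hB hg] : ctbl_gen (psi @` B).
  apply: (ctbl_gen_sub (dedekind_noetherian hR) (B := setT)) => //.
    exact: is_submod_image.
  by exists g.
apply: (extends_quot sA sB lpsi AB psiA (h := h)) => //.
  by move=> x Bx; apply: hg; exists x.
have vg := (very_flat_gen gV).1 vV.
by apply: (very_flat_sub hR _ vg).
Qed.

Variable M : lmodType R.
Implicit Types (c : nat -> M) (n : nat).

Definition fin_span c n : set M :=
  [set x | exists2 p : {poly R}, (size p <= n)%N & x = ev c p].

(** The preimage of the torsion submodule of the quotient of [M] by [fin_span c n]. *)
Definition torsion_over c n : set M :=
  [set x | exists2 a : R, a != 0 & fin_span c n (a *: x)].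

Lemma is_submod_fin_span c n : is_submod (fin_span c n).
Proof.
split=> [|a _ _ [p pn ->] [q qn ->]]; first by exists 0; rewrite ?size_poly0 ?linear0.
exists (a *: p + q); last by rewrite linearP.
apply: leq_trans (size_polyD _ _) _; rewrite geq_max qn andbT.
exact: leq_trans (size_scale_leq _ _) pn.
Qed.

Lemma is_submod_torsion_over c n : is_submod (torsion_over c n).
Proof.
have sF := is_submod_fin_span c n; split=> [|r x y [a a0 Fa] [b b0 Fb]].
  by exists 1; rewrite ?oner_eq0 // scaler0; exact: is_submod0.
exists (a * b); first by rewrite mulf_neq0.
have -> : (a * b) *: (r *: x + y) = (b * r) *: (a *: x) + a *: (b *: y).
  by rewrite scalerDr !scalerA; congr (_ *: _ + _); ring.
by apply: is_submodD => //; exact: is_submodZ.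
Qed.

Lemma fin_span_torsion c n : fin_span c n `<=` torsion_over c n.
Proof. by move=> x Fx; exists 1; rewrite ?oner_eq0// scale1r. Qed.

Lemma fin_span_gen c n i : (i < n)%N -> fin_span c n (c i).
Proof. by move=> ni; exists 'X^i; rewrite ?size_polyXn// evX. Qed.

Lemma fin_spanS c m n : (m <= n)%N -> fin_span c m `<=` fin_span c n.
Proof. by move=> mn _ [p pm ->]; exists p => //; exact: leq_trans mn. Qed.

Lemma torsion_overS c m n : (m <= n)%N -> torsion_over c m `<=` torsion_over c n.
Proof. by move=> mn x [a a0 Fa]; exists a => //; exact: fin_spanS Fa. Qed.

Lemma torsion_over_divisible c n (a : R) x : a != 0 ->
  torsion_over c n (a *: x) -> torsion_over c n x.
Proof.
by move=> a0 [b b0 Fb]; exists (b * a); rewrite ?mulf_neq0// -scalerA.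
Qed.

Lemma eq_fin_span c d n : (forall i, (i < n)%N -> c i = d i) -> fin_span c n = fin_span d n.
Proof.
move=> cd; apply/seteqP; split=> _ [p pn ->]; exists p; rewrite // !(evE _ pn);
  by apply: eq_bigr => i _; rewrite cd.
Qed.

(* The submodules generated by such sequences [c] are the countably generated
   ones of finite rank. *)
Definition very_flat_finite_rank : Prop :=
  forall c n, (forall i, torsion_over c n (c i)) -> very_flat_seq c.

Hypothesis vM : very_flat_finite_rank.

Lemma vffr_torsion_free (a : R) (x : M) : a != 0 -> a *: x = 0 -> x = 0.
Proof.
move=> a0 ax; pose c (i : nat) := x.
have vc : very_flat_seq c by apply: (@vM c 1%N) => i; apply/fin_span_torsion/(@fin_span_gen c 1 0).
by apply: (very_flat_torsion_free hR vc) a0 ax; exists 'X^0; rewrite // evX.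
Qed.

(* Otherwise infinitely many distinct maximal ideals P i occur as annihilators
   of elements y i modulo the span; as a map from the span to the direct sum of
   the R / P i has only finitely many nonzero components, that direct sum
   violates very flatness of the submodule spanned by c and the y i. *)
Lemma torsion_over_power c n :
  exists2 s : R, s != 0 & forall x, torsion_over c n x -> exists k, fin_span c n (s ^+ k *: x).
Proof.
apply: contrapT => nos; pose F := fin_span c n; have sF : is_submod F := is_submod_fin_span c n.
pose ann y : set R^o := [set a | F (a *: y)].
have sann y : is_submod (ann y).
  split=> [|a u v Fu Fv]; rewrite /ann/=; first by rewrite scale0r; exact: is_submod0.
  by rewrite scalerDl -scalerA; apply: is_submodZD.
(* Since [s] fails, some [x] has no multiple [s ^+ k *: x] in [F]; [prime_colon] for the powers of
   [s] turns it into an element with prime annihilator avoiding [s]. The second component is a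
   nonzero member of that annihilator. *)
have /choice[yt ytP] (s : R) : exists yt : M * R, s != 0 ->
    [/\ prime_ideal (ann yt.1), ~ ann yt.1 s, ann yt.1 yt.2 & yt.2 != 0].
  have [s0|] := eqVneq s 0; first by exists (0, 0).
  move=> s0; have [x [a a0 Fa] xs] : exists2 x, torsion_over c n x & forall k, ~ F (s ^+ k *: x).
    apply: contrapT => h; apply: nos; exists s => // x Tx; apply: contrapT => h'.
    by apply: h; exists x => // k Fk; apply: h'; exists k.
  have [||_ [k ->]|r /= [Sr Fr]] := @prime_colon R (dedekind_noetherian hR) M F
    [set z | exists k, z = s ^+ k] x sF.
  - by exists 0%N.
  - by move=> _ _ [k ->] [l ->]; exists (k + l)%N; rewrite exprD.
  - exact: xs.
  exists (r *: x, a) => _; split=> //=.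
  - split=> // F1; apply: (Sr 1) => //; by exists 0%N.
  - by apply: Sr; exists 1%N.
  - by rewrite /ann/= scalerA mulrC -scalerA; exact: is_submodZ.
(* [s i] is the product of the annihilating elements chosen before step [i], so that [P i] contains
   every later [s j] but not [s i]. *)
pose s i := iteri i (fun _ u => u * (yt u).2) 1.
have s0 i : s i != 0.
  elim: i => [|i IHi]; first exact: oner_neq0.
  by rewrite /= mulf_neq0//; have [] := ytP _ IHi.
pose y i := (yt (s i)).1; pose P i := ann (y i).
have prP i : prime_ideal (P i) by have [] := ytP _ (s0 i).
have Ps i : ~ P i (s i) by have [] := ytP _ (s0 i).
have Psj i j : (i < j)%N -> P i (s j).
  elim: j => // j IHj; rewrite ltnS leq_eqVlt => /predU1P[->|/IHj Pij] /=.
    by have [_ _ h _] := ytP _ (s0 j); exact: (is_submodZ (sann _) (s j)).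
  by rewrite mulrC; exact: (is_submodZ (sann _)).
(* Multiplication by [s J] sends all [y j] with [j < J] into [F], which leaves [s J * b J] in the
   prime [P J], and [s J] is not in it. *)
have indep J (b : nat -> R) : F (\sum_(j < J) b j *: y j) -> forall j, (j < J)%N -> P j (b j).
  elim: J => // J IHJ Fb.
  have PJ : P J (b J).
    have [_ _ /(_ (s J) (b J))] := prP J; case=> //; last by move=> /Ps.
    rewrite /P /ann /=; have -> : (s J * b J) *: y J =
        s J *: (\sum_(j < J.+1) b j *: y j) - \sum_(j < J) b j *: (s J *: y j).
      rewrite big_ord_recr /= scalerDr scaler_sumr scalerA.
      rewrite (eq_bigr (fun j : 'I_J => b j *: (s J *: y j))) => [|j _]; last first.
        by rewrite !scalerA mulrC.
      by rewrite addrC addKr.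
    apply: is_submodB => //; first exact: is_submodZ.
    by apply: is_submod_sum => // j _; apply: is_submodZ => //; exact: Psj.
  move=> j; rewrite ltnS leq_eqVlt => /predU1P[->//|]; apply: IHJ.
  have -> : \sum_(j < J) b j *: y j = \sum_(j < J.+1) b j *: y j - b J *: y J.
    by rewrite big_ord_recr /= addrK.
  exact: is_submodB.
(* Generators of [F] come before the [y i]; [PP] below has the unit ideal at the first [n] indices,
   so these contribute no component. *)
pose c' k := if (k < n)%N then c k else y (k - n)%N.
have Fc' : fin_span c' n = F by apply: eq_fin_span => i ni; rewrite /c' ni.
have vc' : very_flat_seq c'.
  apply: (@vM c' n) => k; have [kn|nk] := ltnP k n.
    by apply: fin_span_torsion; exact: fin_span_gen.
  rewrite /torsion_over /= Fc' /c' ltnNge nk /=.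
  by have [_ _ h h0] := ytP _ (s0 (k - n)%N); exists (yt (s (k - n)%N)).2.
pose PP k := if (k < n)%N then setT else P (k - n)%N.
have maxP i : max_or_unit (P i).
  by have [_ _ h h0] := ytP _ (s0 i); exact: (prime_maximal hR (prP i) h h0).
have sPP k : is_submod (PP k) by rewrite /PP; case: ltnP => // _; exact: sann.
have mPP k : max_or_unit (PP k).
  by rewrite /PP; case: ltnP => [_ z|_]; [exists 0 | exact: maxP].
have kerPP f : ev c' f = 0 -> forall k, (n <= k)%N -> PP k f`_k.
  move=> f0 k nk; rewrite /PP ltnNge nk /=.
  have [kf|fk] := ltnP k (size f); last first.
    by rewrite nth_default//; exact: (is_submod0 (sann _)).
  rewrite -[k in f`_k](subnKC nk).
  apply: (@indep (size f) (fun j => f`_(n + j))); last exact: leq_ltn_trans (leq_subr _ _) kf.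
  have : ev c' f = 0 by []; rewrite (@evE _ _ c' (n + size f)) ?leq_addl// big_split_ord /=.
  move=> /eqP; rewrite addrC addr_eq0 => /eqP e.
  rewrite (eq_bigr (fun j : 'I_(size f) => f`_(n + j) *: c' (n + j)%N)); last first.
    by move=> j _; rewrite /c' ltnNge leq_addr /= addKn.
  rewrite e; apply: is_submodN => //; apply: is_submod_sum => // j _.
  by apply: is_submodZ => //; rewrite -Fc'; exact: fin_span_gen.
have PPker k (a : R) : (n <= k)%N -> PP k a ->
    exists2 u : {poly R}, (size u <= n)%N & ev c' (u + a *: 'X^k) = 0.
  move=> nk; rewrite /PP ltnNge nk /= => Pa.
  have [u un e] : fin_span c' n (- (a *: y (k - n)%N)) by rewrite Fc'; exact: is_submodN.
  exists u => //; rewrite linearD linearZ /= -e evX /c' ltnNge nk /=.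
  by rewrite addrC subrr.
have /choice[th thP] i : exists th : R -> R, lin_on (P i) (th : R^o -> R^o) /\
    ~ forall a : R, P i a -> P i (th a).
  have [_ _ h h0] := ytP _ (s0 i).
  by have [th ? ?] := prime_functional hR (prP i) h h0; exists th.
pose ths k : R -> R := if (k < n)%N then fun=> 0 else th (k - n)%N.
have lths k : lin_on (PP k) (ths k : R^o -> R^o).
  rewrite /PP /ths; case: ltnP => [_ a u v _ _|_]; first by rewrite scaler0 addr0.
  exact: (thP _).1.
have [d dP] := test_module_obstruction sPP mPP vc' kerPP PPker lths.
(* Beyond the sizes of all [d j] with [j < n], their coefficients vanish, so the obstruction applies
   at [k]. *)
pose k := (n + \max_(j < n) size (d j))%N.
have nk : (n <= k)%N by exact: leq_addr.
have := dP k nk; rewrite /PP /ths ltnNge nk /= => h; apply: (thP (k - n)%N).2; apply: h => j jn.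
rewrite nth_default; first exact: (is_submod0 (sann _)).
by apply: leq_trans (leq_addl _ _); exact: (leq_bigmax (Ordinal jn)).
Qed.

End FiniteRank.

(** * The union of the torsion closures *)

Section Hull.
Variable R : idomainType.
Hypothesis hR : dedekind_domain R.
Variable M : lmodType R.
Hypothesis vM : very_flat_finite_rank M.
Variable c : nat -> M.

(* The quotient of consecutive torsion closures has rank at most 1, hence
   embeds into some R[s^-1]: x with s^k x = a c_n + (lower terms) goes to a / s^k. *)
Lemma torsion_over_quot n : exists s (psi : M -> localization s),
  lin_on (torsion_over c n.+1) psi /\
  forall x, torsion_over c n.+1 x -> psi x = 0 <-> torsion_over c n x.
Proof.
(* If [c n] is already torsion over the earlier terms, both closures agree and the zero map
   serves. *)
have [Tc|nTc] := pselect (torsion_over c n (c n)).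
  exists 1, (fun=> 0); split=> [a x y _ _|x [a a0 [p pn e]]]; first by rewrite scaler0 addr0.
  split=> // _; apply: (torsion_over_divisible a0); rewrite e.
  apply: (ev_in_size _ _ pn) => [|i]; first exact: is_submod_torsion_over.
  rewrite ltnS leq_eqVlt => /predU1P[->//|ni]; exact/fin_span_torsion/fin_span_gen.
have [s s0 sP] := torsion_over_power hR vM c n.+1.
have sk0 k : s ^+ k != 0 by rewrite expf_neq0.
have indep (a : R) u : fin_span c n u -> torsion_over c n (a *: c n + u) -> a = 0.
  move=> Fu Ta; apply: contrapT => /eqP a0; apply: nTc.
  apply: (torsion_over_divisible a0); rewrite -[_ *: _](addrK u).
  by apply: is_submodB => //; [exact: is_submod_torsion_over | exact: fin_span_torsion].
have /choice[z zP] x : exists z : localization s, torsion_over c n.+1 x ->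
    exists k a u, [/\ fin_span c n u, s ^+ k *: x = a *: c n + u & z = loc_frac s a k].
  have [/sP[k [p pn e]]|nT] := pselect (torsion_over c n.+1 x); last by exists 0.
  exists (loc_frac s p`_n k) => _; have [q qn eq] := ev_recr c pn.
  by exists k, p`_n, (ev c q); split=> //; [exists q | rewrite e].
(* The fraction does not depend on the chosen expression, as no nonzero multiple of [c n] lies in
   the torsion closure of the earlier terms. *)
have zE x k (a : R) u : torsion_over c n.+1 x -> fin_span c n u ->
    s ^+ k *: x = a *: c n + u -> z x = loc_frac s a k.
  move=> /zP[l [b [v [Fv ev ->]]]] Fu eu; apply/loc_frac_eq; exists 0%N.
  rewrite mul1r; apply: (indep _ (s ^+ k *: v - s ^+ l *: u)).
    have sF := is_submod_fin_span c n.
    by apply: is_submodB => //; exact: is_submodZ.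
  have -> : (s ^+ k * b - s ^+ l * a) *: c n + (s ^+ k *: v - s ^+ l *: u)
      = s ^+ k *: (b *: c n + v) - s ^+ l *: (a *: c n + u).
    by rewrite !scalerDr !scalerA scalerBl opprD addrACA.
  rewrite -ev -eu !scalerA mulrC subrr; exact: (is_submod0 (is_submod_torsion_over c n)).
have sT := is_submod_torsion_over c n; have sT1 := is_submod_torsion_over c n.+1.
have sF := is_submod_fin_span c n.
exists s, z; split=> [a x y Tx Ty|x Tx].
  have [k [b [u [Fu eu ->]]]] := zP x Tx; have [l [d [v [Fv ev ->]]]] := zP y Ty.
  rewrite [_ *: loc_frac _ _ _]loc_scaleE loc_fracD.
  apply: (zE _ _ _ (s ^+ l *: (a *: u) + s ^+ k *: v)).
  - exact: is_submodZD.
  - by apply: (is_submodD sF); apply: (is_submodZ sF) => //; exact: (is_submodZ sF).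
  - have -> : s ^+ (k + l) *: (a *: x + y) =
        (s ^+ l * a) *: (s ^+ k *: x) + s ^+ k *: (s ^+ l *: y).
      by rewrite scalerDr !scalerA; congr (_ *: _ + _ *: _); rewrite exprD; ring.
    by rewrite eu ev !scalerDr !scalerA scalerDl addrACA !mulrA.
have [k [a [u [Fu eu ->]]]] := zP x Tx; split=> [/loc_frac_eq[l]|Tn].
  rewrite mulr0 subr0 expr0 mul1r => /eqP; rewrite mulf_eq0 (negPf (sk0 _)) /= => /eqP a0.
  apply: (torsion_over_divisible (sk0 k)); rewrite eu a0 scale0r add0r.
  exact: fin_span_torsion.
have -> : a = 0 by apply: (indep _ u) => //; rewrite -eu; exact: is_submodZ.
by apply/loc_frac_eq; exists 0%N; rewrite !mulr0 subr0 mulr0.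
Qed.

Definition hull : set M := \bigcup_n torsion_over c n.

Lemma is_submod_hull : is_submod hull.
Proof.
split=> [|a x y [m _ Tx] [n _ Ty]].
  by exists 0%N => //; exact: (is_submod0 (is_submod_torsion_over c 0)).
exists (maxn m n) => //; apply: (is_submodZD (is_submod_torsion_over _ _)).
  by apply: torsion_overS Tx; exact: leq_maxl.
by apply: torsion_overS Ty; exact: leq_maxr.
Qed.

Lemma hull_divisible (a : R) x : a != 0 -> hull (a *: x) -> hull x.
Proof. by move=> a0 [n _ Tn]; exists n => //; exact: torsion_over_divisible Tn. Qed.

Lemma hull_gen i : hull (c i).
Proof. by exists i.+1 => //; apply/fin_span_torsion/fin_span_gen. Qed.

Lemma torsion_over0 x : torsion_over c 0 x <-> x = 0.
Proof.
split=> [[a a0 [p]]|->]; last exact: (is_submod0 (is_submod_torsion_over c 0)).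
rewrite leqn0 size_poly_eq0 => /eqP ->; rewrite linear0.
exact: (vffr_torsion_free hR vM).
Qed.

Lemma ctbl_gen_torsion_over n : ctbl_gen (torsion_over c n).
Proof.
elim: n => [|n IHn].
  exists (fun=> 0) => [i|x /torsion_over0 ->]; first exact/torsion_over0.
  by exists 0; rewrite linear0.
have [s [psi [lpsi psi0]]] := torsion_over_quot n; have sT := is_submod_torsion_over c n.+1.
apply: (ctbl_gen_ext sT lpsi).
  suff -> : [set x | torsion_over c n.+1 x /\ psi x = 0] = torsion_over c n by [].
  apply/seteqP; split=> [x [Tx /(psi0 _ Tx)]//|x Tx].
  have Tx' : torsion_over c n.+1 x by exact: torsion_overS Tx.
  by split=> //; apply/(psi0 _ Tx').
apply: (ctbl_gen_sub (dedekind_noetherian hR) (B := setT)) => //.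
  exact: is_submod_image.
by exists (loc_frac s 1) => // x _; exact: loc_gen.
Qed.

(** The preimages of the torsion closures in [{poly R}] start at [ker (ev g)] because [M] is torsion
    free. Each step embeds into some [R[s^-1]], which is very flat by the very definition of
    contraadjusted modules. *)
Lemma hull_very_flat : exists g : nat -> M,
  [/\ forall i, hull (g i), forall x, hull x -> exists p, x = ev g p & very_flat_seq g].
Proof.
have [g hg gh] := ctbl_gen_bigcup is_submod_hull ctbl_gen_torsion_over.
exists g; split=> // D cD; pose A n := ev g @^-1` torsion_over c n.
have -> : ker (ev g) = A 0%N by apply/seteqP; split=> p /torsion_over0.
have sA n : is_submod (A n) by apply: is_submod_preimage; exact: is_submod_torsion_over.
have AS n : A n `<=` A n.+1 by move=> p; apply: torsion_overS.
apply: extends_nat_chain => // [p|n].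
  have [n _ Tn] : hull (ev g p) by apply: ev_in => //; exact: is_submod_hull.
  by exists n.
have [s [psi [lpsi psi0]]] := torsion_over_quot n.
apply: (@extends_very_flat_quot R hR _ (localization s) D _ _ (psi \o ev g) (loc_frac s 1)) => //.
- by move=> a p q Ap Aq; rewrite /= linearP lpsi.
- by move=> p Ap; exact: psi0.
- exact: loc_gen.
Qed.

End Hull.

(** * Common denominators *)

Section Fractions.
Variable R : idomainType.
Local Notation K := {fraction R}.
Local Notation "a %:F" := (@FracField.tofrac R a).

Lemma fraction_denom (z : K) : exists2 d : R, d != 0 & exists n, d%:F * z = n%:F.
Proof.
elim/generic_quotient.quotW: z => x; exists x.2; first exact: denom_ratioP.
exists x.1; unlock FracField.tofrac; rewrite -[LHS]FracField.pi_mul.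
apply/generic_quotient.eqmodP.
rewrite /= /FracField.equivf /FracField.mulf !numden_Ratio ?mulf_neq0 ?oner_neq0 ?denom_ratioP//.
by rewrite !mul1r mulr1 mulrC.
Qed.

Lemma fraction_common_denom (I : finType) (z : I -> K) :
  exists2 d : R, d != 0 & exists n : I -> R, forall i, d%:F * z i = (n i)%:F.
Proof.
have /choice[dn dnP] i : exists dn : R * R, dn.1 != 0 /\ dn.1%:F * z i = dn.2%:F.
  by have [d d0 [n e]] := fraction_denom (z i); exists (d, n).
exists (\prod_i (dn i).1); first by apply/prodf_neq0 => i _; case: (dnP i).
exists (fun i => (dn i).2 * \prod_(j | j != i) (dn j).1) => i.
by rewrite (bigD1 i)//= !tofracM mulrAC (dnP i).2.
Qed.

End Fractions.

(** * Purity and divisibility *)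

Section Purity.
Variable R : idomainType.
Hypothesis hR : dedekind_domain R.

Let eq_cols m n (A B : 'M[R]_(m, n)) : (forall j, col j A = col j B) -> A = B.
Proof. by move=> AB; apply/matrixP => i j; have /colP/(_ i) := AB j; rewrite !mxE. Qed.

(* [sigma] below splits v |-> A *m v onto its image, a submodule of R^m and thus
   projective; E is the composite of the two. *)
Lemma matrix_weak_inverse m n (A : 'M[R]_(m, n)) :
  exists (E : 'M[R]_n) (B : 'M[R]_(n, m)) (t : R),
    [/\ t != 0, t *: E = B *m A & A *m E = A].
Proof.
pose u (p : {poly R}) : 'cV[R]_m := \col_i p`_i.
have [u' uE] : exists u' : {linear {poly R} -> 'cV[R]_m}, u' =1 u.
  by apply: lin_on_linear => a p q _ _; apply/colP => i; rewrite !mxE coefD coefZ.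
have [w wE] : exists w : {linear 'cV[R]_n -> 'cV[R]_m}, w =1 mulmx A.
  by apply: lin_on_linear => a v v' _ _; rewrite mulmxDr scalemxAr.
pose q (v : 'cV[R]_m) := rVpoly v^T.
have uq v : u (q v) = v by apply/colP => i; rewrite !mxE coef_rVpoly_ord mxE.
pose L : set {poly R} := [set p | exists v, w v = u' p].
have sL : is_submod L.
  split=> [|a p p' [v ev] [v' ev']]; first by exists 0; rewrite !linear0.
  by exists (a *: v + v'); rewrite !linearP ev ev'.
have Lw p : L p -> exists v, w v = u' p by [].
have [sigma lsigma sigmaP] := sub_poly_projective hR sL Lw.
pose E := \matrix_(i, j) sigma (q (col j A)) i 0.
have Lq v : L (q (A *m v)) by exists v; rewrite wE uE uq.
have Ecol j : col j E = sigma (q (col j A)) by apply/colP => i; rewrite !mxE.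
have AE : A *m E = A.
  apply: eq_cols => j; rewrite !colE -mulmxA -colE Ecol -wE sigmaP.
    by rewrite uE uq colE.
  by rewrite colE; exact: Lq.
have q_lin : lin_on setT q by move=> a v v' _ _; rewrite /q !linearP.
have Emul (v : 'cV[R]_n) : E *m v = sigma (q (A *m v)).
  have -> : A *m v = \sum_j v j 0 *: col j A.
    by apply/colP => i; rewrite mxE summxE; apply: eq_bigr => j _; rewrite !mxE mulrC.
  have Lc j : L (q (col j A)) by rewrite colE; exact: Lq.
  rewrite (lin_on_sum (is_submodT _) q_lin)//.
  rewrite (lin_on_sum sL lsigma) => [|j _]; last first.
    by rewrite (lin_onZ (is_submodT _) q_lin)//; exact: (is_submodZ sL).
  apply/colP => i; rewrite mxE summxE; apply: eq_bigr => j _.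
  rewrite (lin_onZ (is_submodT _) q_lin)// (lin_onZ sL lsigma)//.
  by rewrite !mxE mulrC.
pose F := map_mx (@FracField.tofrac R).
have Finj k l : injective (F k l).
  move=> X Y /matrixP e; apply/matrixP => i j; have := e i j; rewrite !mxE => /eqP.
  by rewrite tofrac_eq => /eqP.
(* Every vector killed by [A] is killed by [E], so over the fraction field the rows of [E] lie in
   the row space of [A]; [t] is a common denominator of the resulting factor [D]. *)
have /submxP[D eD] : (F _ _ E <= F _ _ A)%MS.
  rewrite submxE; set Z := cokermx _.
  have [d d0 [Y YE]] := fraction_common_denom (fun ij : 'I_n * 'I_n => Z ij.1 ij.2).
  pose Z' := \matrix_(i, j) Y (i, j).
  have ZE : FracField.tofrac d *: Z = F _ _ Z'.
    by apply/matrixP => i j; rewrite [RHS]mxE [Z' _ _]mxE -(YE (i, j)) mxE.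
  have dF : FracField.tofrac d != 0 by rewrite tofrac_eq0.
  have AZ : A *m Z' = 0.
    apply: Finj; rewrite /F map_mxM /= -/(F _ _ Z') -ZE.
    by rewrite -scalemxAr mulmx_coker scaler0 map_mx0.
  have EZ : E *m Z' = 0.
    apply: eq_cols => j; rewrite !colE -mulmxA -colE Emul.
    rewrite colE mulmxA AZ mul0mx (lin_on0 (is_submodT _) q_lin) mul0mx.
    exact: (lin_on0 sL lsigma).
  rewrite -(inj_eq (scalerI dF)) scalemxAr ZE scaler0 -map_mxM EZ; apply/eqP; exact: map_mx0.
have [t t0 [b bE]] := fraction_common_denom (fun ij : 'I_n * 'I_m => D ij.1 ij.2).
exists E, (\matrix_(i, j) b (i, j)), t; split=> //.
apply: Finj; rewrite /F map_mxM /= map_mxZ /=.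
rewrite -/(F _ _ E) eD scalemxAl; congr (_ *m _).
by apply/matrixP => i j; rewrite [RHS]mxE [in RHS]mxE -(bE (i, j)) mxE.
Qed.

(** From a solution [x] in [M] the vector [E x] is again a solution, as [A E = A], and it lies in
    [N] because [t E x = B A x = B b] does. *)
Lemma pure_divisible (M : lmodType R) (N : submodClosed M) :
  (forall (a : R) x, a != 0 -> a *: x \in N -> x \in N) -> pure N.
Proof.
move=> divN m n A b Nb [x xb]; have [E [B [t [t0 tE AE]]]] := matrix_weak_inverse A.
exists (fun j => \sum_l E j l *: x l) => [j|i].
  apply: (divN t) => //; rewrite scaler_sumr.
  have -> : \sum_l t *: (E j l *: x l) = \sum_i B j i *: b i.
    transitivity (\sum_l (B *m A) j l *: x l).
      by apply: eq_bigr => l _; rewrite -tE mxE scalerA.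
    transitivity (\sum_l \sum_i (B j i * A i l) *: x l).
      by apply: eq_bigr => l _; rewrite mxE scaler_suml.
    rewrite exchange_big; apply: eq_bigr => i _ /=.
    by rewrite -xb scaler_sumr; apply: eq_bigr => l _; rewrite scalerA.
  by apply: rpred_sum => i _; apply: rpredZ.
transitivity (\sum_l (A *m E) i l *: x l); last by rewrite AE xb.
transitivity (\sum_j \sum_l (A i j * E j l) *: x l).
  by apply: eq_bigr => j _; rewrite scaler_sumr; apply: eq_bigr => l _; rewrite scalerA.
by rewrite exchange_big; apply: eq_bigr => l _ /=; rewrite mxE scaler_suml.
Qed.

(** The single equation with coefficient [a] and constant [a *: x] has a solution in [N], and
    torsion freeness makes it equal to [x]. *)
Lemma pure_torsion_free (M : lmodType R) (N : submodClosed M) (a : R) (x : M) :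
  pure N -> (forall (b : R) y, b != 0 -> b *: y = 0 :> M -> y = 0) ->
  a != 0 -> a *: x \in N -> x \in N.
Proof.
move=> pN tfM a0 Nax.
have ax : exists z : 'I_1 -> M, forall i, \sum_j (a%:M : 'M_1) i j *: z j = a *: x.
  by exists (fun=> x) => i; rewrite big_ord1 mxE ord1 eqxx mulr1n.
have [y Ny e] := pN 1%N 1%N (a%:M) (fun=> a *: x) (fun=> Nax)
  ax.
have /eqP := e ord0; rewrite big_ord1 mxE eqxx mulr1n -subr_eq0 -scalerBr => /eqP.
by move=> /(tfM _ _ a0)/eqP; rewrite subr_eq0 => /eqP <-.
Qed.

End Purity.

(** * Rank and torsion over finitely many elements *)

Lemma isomorphic_rV (K : fieldType) (V : lmodType K) n (b : 'I_n -> V) :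
  (forall v, exists r : 'rV[K]_n, v = \sum_j r 0 j *: b j) ->
  exists k, isomorphic V 'rV[K]_k.
Proof.
move=> gb.
pose Q k := `[< exists b : 'I_k -> V,
  forall v, exists r : 'rV[K]_k, v = \sum_j r 0 j *: b j >].
have exQ : exists k, Q k by exists n; apply/asboolP; exists b.
case: (ex_minnP exQ) => {n b gb exQ}k /asboolP[b gb] kmin.
exists k; have /choice[f fP] := gb.
have inj (r : 'rV[K]_k) : \sum_j r 0 j *: b j = 0 -> r = 0.
  move=> r0; apply/rowP => i; rewrite mxE; apply: contrapT => /eqP ri.
  case: k b gb kmin r r0 i ri {f fP} => [|k] b gb kmin r r0 i ri; first by case: i ri.
  suff /kmin : Q k by rewrite ltnn.
  apply/asboolP; exists (fun j => b (fintype.lift i j)) => v; have [q ->] := gb v.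
  (* The relation [r] is solved for [b i], which can then be omitted, against the minimality of the
     number of generators. *)
  exists (\row_j (q 0 (fintype.lift i j) - q 0 i / r 0 i * r 0 (fintype.lift i j))).
  transitivity (\sum_j q 0 j *: b j - (q 0 i / r 0 i) *: \sum_j r 0 j *: b j).
    by rewrite r0 scaler0 subr0.
  rewrite !(bigD1_ord i)//= scalerDr !scalerA divfK// opprD addrACA subrr add0r.
  rewrite scaler_sumr -sumrB; apply: eq_bigr => j _.
  by rewrite mxE scalerBl !scalerA.
have fE v (r : 'rV[K]_k) : v = \sum_j r 0 j *: b j -> f v = r.
  move=> e; apply/eqP; rewrite -subr_eq0; apply/eqP/inj.
  transitivity (\sum_j f v 0 j *: b j - \sum_j r 0 j *: b j); last by rewrite -fP -e subrr.
  by rewrite -sumrB; apply: eq_bigr => j _; rewrite -scalerBl !mxE.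
have [F FE] : exists F : {linear V -> 'rV[K]_k}, F =1 f.
  apply: lin_on_linear => a x y _ _; apply: fE.
  transitivity (a *: (\sum_j f x 0 j *: b j) + \sum_j f y 0 j *: b j); first by rewrite -!fP.
  rewrite scaler_sumr -big_split; apply: eq_bigr => j _ /=.
  by rewrite !mxE scalerDl scalerA.
exists F; exists (fun r : 'rV[K]_k => \sum_j r 0 j *: b j) => [v|r]; first by rewrite FE -fP.
by rewrite FE; exact: fE.
Qed.

Section Rank.
Variable R : idomainType.
Variable U : lmodType R.
Local Notation K := {fraction R}.
Local Notation "a %:F" := (@FracField.tofrac R a).
Local Notation tens x := (fractens x 1).

Lemma tens_linear (a : R) (x y : U) : tens (a *: x + y) = a%:F *: tens x + tens y.
Proof.
have [tD _ tZ] := fractens_balanced U; rewrite tD tZ mulr1; congr (_ + _).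
by rewrite /fractens scale1r.
Qed.

Lemma tensB (x y : U) : tens (x - y) = tens x - tens y.
Proof. by rewrite -scaleN1r addrC tens_linear rmorphN1 scaleN1r addrC. Qed.

Lemma tensZ (a : R) (x : U) : tens (a *: x) = a%:F *: tens x.
Proof.
have t0 : tens (0 : U) = 0 by rewrite -(subrr (0 : U)) tensB subrr.
by rewrite -[a *: x]addr0 tens_linear t0 addr0.
Qed.

Lemma tens_sum I (r : seq I) (P : pred I) (F : I -> U) :
  tens (\sum_(i <- r | P i) F i) = \sum_(i <- r | P i) tens (F i).
Proof.
elim/big_rec2: _ => [|i u v _ IH]; first by rewrite -(subrr (0 : U)) tensB subrr.
by rewrite -[F i]scale1r tens_linear rmorph1 !scale1r -IH.
Qed.

Lemma fracmod_ind (A : set (fracmod U)) : is_submod A -> (forall x, A (tens x)) ->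
  forall v, A v.
Proof.
move=> sA At v; have [d ->] := quotmap_surj v.
rewrite -[d]freeg_sumE linear_sum; apply: is_submod_sum => // x _.
have -> : << coeff x d *g x >> = coeff x d *: << x >>.
  by apply/eqP/freeg_eqP => y; rewrite coeffZ !coeffU mul1r.
rewrite linearZ; apply: is_submodZ => //.
by have := At x; rewrite /fractens scale1r.
Qed.

(** [W] collects the formal sums that, after clearing a denominator, have coefficients in [R] and
    sum to 0 in [U]. It is a submodule containing all relators, hence also [<< y >>]. *)
Lemma tens_torsion (y : U) : tens y = 0 -> exists2 a : R, a != 0 & a *: y = 0.
Proof.
rewrite /fractens scale1r => ty.
pose comb (s : seq (R * U)) : {freeg U / K} := \sum_(u <- s) (u.1)%:F *: << u.2 >>.
pose W : set {freeg U / K} := [set d | exists2 a : R, a != 0 &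
  exists2 s, a%:F *: d = comb s & \sum_(u <- s) u.1 *: u.2 = 0].
have combZ (a : R) s : comb [seq (a * u.1, u.2) | u <- s] = a%:F *: comb s.
  rewrite /comb big_map scaler_sumr; apply: eq_bigr => u _.
  by rewrite scalerA tofracM.
have sumZ (a : R) (s : seq (R * U)) : \sum_(u <- [seq (a * u.1, u.2) | u <- s]) u.1 *: u.2 =
    a *: \sum_(u <- s) u.1 *: u.2.
  by rewrite big_map scaler_sumr; apply: eq_bigr => u _; rewrite scalerA.
have sW : is_submod W.
  split=> [|q d e [a a0 [s ds s0]] [b b0 [t et t0]]].
    by exists 1; rewrite ?oner_neq0//; exists [::]; rewrite ?scaler0 /comb ?big_nil.
  have [m m0 [n mn]] := fraction_denom q.
  exists (m * a * b); first by rewrite !mulf_neq0.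
  exists ([seq (n * b * u.1, u.2) | u <- s] ++ [seq (m * a * u.1, u.2) | u <- t]).
    rewrite /comb big_cat -!/(comb _) !combZ -ds -et scalerDr !scalerA !tofracM -mn.
    by congr (_ *: _ + _ *: _); ring.
  by rewrite big_cat /= !sumZ s0 t0 !scaler0 addr0.
have [a a0 [s as_ s0]] : W << y >>.
  have sub : @fracmod_relators R U `<=` [set` mk_submod sW].
    move=> d [[x [z ->]]|[b [x ->]]]; apply/mk_submodE; exists 1; rewrite ?oner_neq0//.
      exists [:: (1, x + z); (-1, x); (-1, z)].
        by rewrite /comb !big_cons big_nil /= addr0 rmorph1 rmorphN1 !scale1r !scaleN1r addrA.
      by rewrite !big_cons big_nil /= addr0 scale1r !scaleN1r addrA -addrA -opprD subrr.
    exists [:: (1, b *: x); (-b, x)].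
      by rewrite /comb !big_cons big_nil /= addr0 rmorph1 rmorphN !scale1r scaleNr.
    by rewrite !big_cons big_nil /= addr0 scale1r scaleNr subrr.
  apply/(mk_submodE sW).
  apply: (span_min sub) => /=.
  have /quotmap_eq : quotmap (submod_span (@fracmod_relators R U)) << y >> =
    quotmap (submod_span (@fracmod_relators R U)) 0 by rewrite ty linear0.
  by rewrite subr0.
exists a => //; rewrite -[RHS]s0.
(* Both sides are written over one duplicate-free list of elements, so that comparing coefficients
   in the free module over the fraction field gives an identity over [R]. *)
pose Z := undup (y :: [seq u.2 | u <- s]).
have uZ : uniq Z := undup_uniq _.
have one z (b : R) : z \in Z -> b *: z = \sum_(w <- Z) (b * (z == w)%:R) *: w.
  move=> zZ; rewrite (bigD1_seq z)//= eqxx mulr1 big1 ?addr0// => w /negPf wz.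
  by rewrite eq_sym wz mulr0 scale0r.
have yZ : y \in Z by rewrite mem_undup mem_head.
have -> : \sum_(u <- s) u.1 *: u.2 = \sum_(u <- s) \sum_(w <- Z) (u.1 * (u.2 == w)%:R) *: w.
  rewrite big_seq [RHS]big_seq; apply: eq_bigr => u us; apply: one.
  by rewrite mem_undup inE (map_f (fun v : R * U => v.2) us) orbT.
rewrite (one y)// exchange_big; apply: eq_bigr => w _ /=; rewrite -scaler_suml; congr (_ *: _).
apply/eqP; rewrite -tofrac_eq; apply/eqP; rewrite rmorph_sum /=.
have := congr1 (coeff w) as_; rewrite coeffZ coeffU mul1r /comb raddf_sum /= => h.
transitivity (a%:F * (y == w)%:R).
  by rewrite tofracM; case: eqP => _; rewrite ?tofrac1 ?tofrac0.
rewrite h; apply: eq_bigr => u _; rewrite coeffZ coeffU mul1r tofracM.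
by case: eqP => _; rewrite ?tofrac1 ?tofrac0.
Qed.

(** The sequence [c] lists the elements of [U] occurring in expressions for the preimages of the
    unit vectors. After clearing denominators, a multiple of [x] minus a combination of the [c j]
    has zero image in the tensor product and is therefore torsion. *)
Lemma finite_rank_torsion_over : finite_rank U ->
  exists n (c : nat -> U), forall x, torsion_over c n x.
Proof.
move=> [k [f [g fg gf]]].
have fin v : exists s : seq (K * U), v = \sum_(u <- s) u.1 *: tens u.2.
  move: v; apply: fracmod_ind => [|x]; last first.
    by exists [:: (1, x)]; rewrite big_seq1 scale1r.
  split=> [|q _ _ [s ->] [t ->]]; first by exists [::]; rewrite big_nil.
  exists ([seq (q * u.1, u.2) | u <- s] ++ t); rewrite big_cat big_map; congr (_ + _).
  by rewrite scaler_sumr; apply: eq_bigr => u _; rewrite scalerA.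
have /choice[s sP] (i : 'I_k) := fin (g (delta_mx 0 i)).
pose S := flatten [seq [seq u.2 | u <- s i] | i : 'I_k].
pose c := nth (0 : U) S; pose n := size S; exists n, c => x.
pose A : set (fracmod U) := [set v | exists q : 'I_n -> K, v = \sum_j q j *: tens (c j)].
have sA : is_submod A.
  split=> [|a _ _ [q ->] [r ->]].
    by exists (fun=> 0); rewrite big1// => j _; rewrite scale0r.
  exists (fun j => a * q j + r j); rewrite scaler_sumr -big_split; apply: eq_bigr => j _ /=.
  by rewrite scalerDl scalerA.
have AS z : z \in S -> A (tens z).
  move=> zS; have zn : (index z S < n)%N by rewrite index_mem.
  exists (fun j => (j == Ordinal zn)%:R); rewrite (bigD1 (Ordinal zn))//= eqxx scale1r.
  rewrite big1 ?addr0 => [|j /negPf ->]; last by rewrite scale0r.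
  by rewrite /c nth_index.
have [q xq] : A (tens x).
  rewrite -[tens x]fg (row_sum_delta (f (tens x))); move: (f (tens x)) => r.
  have -> : g (\sum_(j < k) r 0 j *: delta_mx 0 j) = \sum_(j < k) r 0 j *: g (delta_mx 0 j).
    rewrite -[RHS]fg linear_sum; congr g; apply: eq_bigr => j _.
    by rewrite linearZ /= gf.
  apply: is_submod_sum => // i _; apply: is_submodZ => //; rewrite sP big_seq.
  apply: is_submod_sum => // u us; apply: is_submodZ => //; apply: AS.
  by apply/flatten_mapP; exists i; rewrite ?mem_enum//; exact: map_f.
have [d d0 [m dm]] := fraction_common_denom q.
have [|a a0 e] := @tens_torsion (d *: x - \sum_j m j *: c j).
  rewrite tensB tensZ tens_sum xq scaler_sumr; apply/eqP; rewrite subr_eq0; apply/eqP.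
  by apply: eq_bigr => j _; rewrite tensZ scalerA dm.
exists (a * d); first by rewrite mulf_neq0.
have sF := is_submod_fin_span c n.
move: e; rewrite scalerBr scalerA => /eqP; rewrite subr_eq0 => /eqP ->.
apply: is_submodZ => //; apply: is_submod_sum => // j _; apply: is_submodZ => //.
exact: fin_span_gen.
Qed.

Lemma torsion_over_finite_rank n (c : nat -> U) :
  (forall x, torsion_over c n x) -> finite_rank U.
Proof.
move=> Tc; apply: (@isomorphic_rV _ (fracmod U) n (fun j => tens (c j))).
apply: fracmod_ind => [|x].
  split=> [|a _ _ [q ->] [r ->]].
    by exists 0; rewrite big1// => j _; rewrite mxE scale0r.
  exists (a *: q + r); rewrite scaler_sumr -big_split; apply: eq_bigr => j _ /=.
  by rewrite !mxE scalerDl scalerA.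
have [a a0 [p pn e]] := Tc x; have aF : a%:F != 0 by rewrite tofrac_eq0.
exists (\row_j ((p`_j)%:F / a%:F)); apply: (scalerI aF).
rewrite -tensZ e (evE _ pn) tens_sum scaler_sumr; apply: eq_bigr => j _.
by rewrite tensZ mxE scalerA mulrC divfK.
Qed.

End Rank.

(** * Countable presentation *)

Section CountablyPresented.
Variable R : comNzRingType.

Lemma first_isomorphism (X U : lmodType R) (phi : {linear X -> U}) (K : submodClosed X) :
  (forall u, exists x, phi x = u) -> (forall x, x \in K <-> phi x = 0) ->
  isomorphic (quotmod K) U.
Proof.
move=> /choice[s sP] Kphi.
have phiE x y : quotmap K x = quotmap K y <-> phi x = phi y.
  split=> [/quotmap_eq/Kphi/eqP|e]; first by rewrite linearB subr_eq0 => /eqP.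
  by apply/quotmap_eq/Kphi; rewrite linearB e subrr.
have /choice[o oP] (q : quotmod K) : exists u, forall x, quotmap K x = q -> phi x = u.
  by have [x ->] := quotmap_surj q; exists (phi x) => y /phiE.
have oE x : o (quotmap K x) = phi x by rewrite -(oP _ x).
have [F FE] : exists F : {linear quotmod K -> U}, F =1 o.
  apply: lin_on_linear => a q r _ _; have [x ->] := quotmap_surj q; have [y ->] := quotmap_surj r.
  by rewrite -linearP !oE linearP.
exists F; exists (quotmap K \o s) => [q|u]; last by rewrite FE /= oE.
have [x ->] := quotmap_surj q.
by rewrite FE oE /=; apply/phiE.
Qed.

Lemma freegU_scale (J : choiceType) (c : R) (j : J) : << c *g j >> = c *: << j >> :> {freeg J / R}.
Proof. by apply/eqP/freeg_eqP => i; rewrite coeffZ !coeffU mul1r. Qed.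

Lemma countably_presented_gen (U : lmodType R) : countably_presented U ->
  exists c : nat -> U, forall x, exists p, x = ev c p.
Proof.
move=> [J [K [_ [f [g fg gf]]]]].
pose c i : U := if unpickle i is Some j then f (quotmap K << j : J >>) else 0.
exists c => x; suff [p _ <-] : range (ev c) x by exists p.
rewrite -[x]gf; have [d ->] := quotmap_surj (g x).
rewrite -[d]freeg_sumE !linear_sum; apply: is_submod_sum => [|j _].
  exact: is_submod_range_ev.
rewrite freegU_scale; exists (coeff j d *: 'X^(pickle j)) => //.
by rewrite linearZ /= evX /c pickleK !linearZ.
Qed.

End CountablyPresented.

(** [T] and [ev b] identify [{freeg nat / R}] with [{poly R}]; the kernel of the presentation is
    countably generated because [R] is noetherian. *)
Lemma countably_generated_presented (R : idomainType) (U : lmodType R) (g : nat -> U) :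
  noetherian R -> (forall x, exists p, x = ev g p) -> countably_presented U.
Proof.
move=> noethR gU.
pose t (d : {freeg nat / R}) : {poly R} := \poly_(i < (\max_(j <- dom d) j).+1) coeff i d.
have tE d i : (t d)`_i = coeff i d.
  rewrite coef_poly ltnS; case: leqP => // di; rewrite coeff_outdom//.
  apply: contraTN di => iin; rewrite -leqNgt.
  exact: (@leq_bigmax_seq _ (dom d) xpredT (fun j => j) i iin erefl).
have [T TE] : exists T : {linear {freeg nat / R} -> {poly R}}, T =1 t.
  by apply: lin_on_linear => a d e _ _; apply/polyP => i; rewrite coefD coefZ !tE coeffD coeffZ.
pose b i : {freeg nat / R} := << i >>.
have bT d : d = ev b (T d).
  apply/eqP/freeg_eqP => k; rewrite /ev raddf_sum /=.
  rewrite (eq_bigr (fun i : 'I_(size (T d)) => (T d)`_i * (i == k :> nat)%:R)); last first.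
    by move=> i _; rewrite coeffZ coeffU mul1r.
  have [kT|Tk] := ltnP k (size (T d)).
    rewrite (bigD1 (Ordinal kT))//= eqxx mulr1 big1 ?addr0 ?TE ?tE// => i ik.
    by rewrite (_ : (_ == _) = false) ?mulr0//; apply: contraNF ik => /eqP e; apply/eqP/val_inj.
  rewrite big1 => [|i _]; last first.
    rewrite (_ : (_ == _) = false) ?mulr0//; apply/negP => /eqP e; move: Tk;
    by rewrite -e leqNgt ltn_ord.
  by rewrite -tE -TE nth_default.
have Tev p : T (ev b p) = p.
  apply/polyP => k; rewrite TE tE /ev raddf_sum /= -[in RHS](coefK p) coef_poly.
  rewrite (eq_bigr (fun i : 'I_(size p) => p`_i * (i == k :> nat)%:R)); last first.
    by move=> i _; rewrite coeffZ coeffU mul1r.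
  case: ltnP => [kp|pk].
    rewrite (bigD1 (Ordinal kp))//= eqxx mulr1 big1 ?addr0// => i ik.
    by rewrite (_ : (_ == _) = false) ?mulr0//; apply: contraNF ik => /eqP e; apply/eqP/val_inj.
  rewrite big1// => i _.
  rewrite (_ : (_ == _) = false) ?mulr0//; apply/negP => /eqP e; move: pk;
  by rewrite -e leqNgt ltn_ord.
have [phi phiE] : exists phi : {linear {freeg nat / R} -> U}, phi =1 ev g \o T.
  by apply: lin_on_linear => a d e _ _; rewrite /= !linearP.
pose K := mk_submod (is_submod_ker phi).
exists (nat : countType), K; split.
  apply/ctbl_gen_submod; apply: (ctbl_gen_sub noethR (B := setT)) => //.
    exact: submodClosed_is_submod.
  by exists b => // d _; exists (T d).
apply: (first_isomorphism (phi := phi)) => [u|x]; last exact: mk_submodE.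
by have [p ->] := gU u; exists (ev b p); rewrite phiE /= Tev.
Qed.

(** * Countable filtrations *)

Section Filtrations.
Variable R : idomainType.
Hypothesis hR : dedekind_domain R.

Lemma well_order_min d (T : porderType d) (A : set T) : well_order (<=%O : rel T) ->
  A !=set0 -> exists2 b, A b & forall a, A a -> (b <= a)%O.
Proof.
move=> wo [a Aa]; have [|b [[/asboolP Ab bmin] _]] := wo (fun x => `[< A x >]).
  by exists a; apply/asboolP.
by exists b => // x Ax; apply: bmin; apply/asboolP.
Qed.

(** The filtration is pulled back to a chain in [{poly R}] from [ker (ev g)] to the whole module, to
    which Eklof's lemma applies. *)
Lemma filtered_very_flat (U : lmodType R) (g : nat -> U) :
  (forall x, exists p, x = ev g p) ->
  countably_filtered (fun V => countably_presented V /\ very_flat V) U -> very_flat U.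
Proof.
move=> gU [d [T [F [_ [wo Fmono F01 Flim Fsucc]]]]] D cD; apply: (Ext1_vanishes_gen gU).
pose A a : set {poly R} := ev g @^-1` [set` F a].
have sA a : is_submod (A a) by apply: is_submod_preimage; exact: submodClosed_is_submod.
have Amono a b : (a <= b)%O -> A a `<=` A b by move=> ab p; exact: Fmono.
have A0 : ker (ev g) = A \bot%O.
  by apply/seteqP; split=> p /=; [move=> h; apply/(F01 _).1 | move/(F01 _).1].
have A1 p : A \top%O p by exact: (F01 _).2.
rewrite A0; apply: (@extends_chain R _ D [set B | exists a, B = A a]).
- by exists \bot%O.
- by move=> _ [a ->].
- move=> CC CF [B0 CB0] _.
  (* [b] is the least index whose term contains the union. If no member of [CC] has an index at or
     above [b], then [b] is a limit, and minimality makes the union exhaust [A b]. *)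
  have [|b CAb bmin] := @well_order_min _ T [set b | \bigcup_(B in CC) B `<=` A b] wo.
    by exists \top%O => p _; exact: A1.
  exists b; apply/seteqP; split=> // p Ap.
  have [[c [CAc bc]]|nc] := pselect (exists c, CC (A c) /\ (b <= c)%O).
    by exists (A c) => //; exact: (Amono b c).
  have cb c : CC (A c) -> (c < b)%O.
    by move=> CAc; rewrite ltNge; apply/negP => bc; apply: nc; exists c.
  have limb : is_limit b.
    split=> [b0|[a [ab asucc]]].
      by have [c Bc] := CF _ CB0; have := cb c; rewrite -Bc b0 ltx0 => /(_ CB0).
    suff : (b <= a)%O by rewrite leNgt ab.
    apply: bmin => q [B CB Bq]; have [c Bc] := CF _ CB.
    apply: (Amono c a); last by rewrite -Bc.
    rewrite leNgt; apply/negP => /asucc; rewrite leNgt cb//.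
    by rewrite -Bc.
  have [a ab Fa] := (Flim b limb (ev g p)).1 Ap.
  apply: contrapT => np; suff : (b <= a)%O by rewrite leNgt ab.
  apply: bmin => q [B CB Bq]; have [c Bc] := CF _ CB.
  have [ca|ac] := leP c a; first by apply: (Amono c a) => //; rewrite -Bc.
  exfalso; apply: np; exists B => //; rewrite Bc; apply: (Amono a c) => //; exact: ltW.
- move=> _ [a ->]; have [AT|nT] := pselect (A a = setT); [by left | right].
  (* The least [b] with [A b] not inside [A a] cannot be a limit, so it succeeds some [c], and
     [A c = A a] even if terms are repeated between [a] and [c]. *)
  have [|b Ab bmin] := @well_order_min _ T [set b | ~ A b `<=` A a] wo.
    apply: contrapT => h; apply: nT; apply/seteqP; split=> // p _.
    by apply: contrapT => np; apply: h; exists \top%O => /(_ p (A1 p)).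
  have lt_sub c : (c < b)%O -> A c `<=` A a.
    by move=> cb; apply: contrapT => /bmin; rewrite leNgt cb.
  have ab : (a < b)%O by rewrite ltNge; apply/negP => ba; apply: Ab; exact: Amono.
  have [c [cb csucc]] : exists c, is_succ c b.
    apply: contrapT => nsucc; apply: Ab => p Ap.
    have limb : is_limit b by split=> // b0; rewrite b0 ltx0 in ab.
    by have [c cb Fc] := (Flim b limb (ev g p)).1 Ap; exact: (lt_sub c).
  have AE : A c = A a.
    apply/seteqP; split; first exact: lt_sub.
    apply: Amono; rewrite leNgt; apply/negP => /csucc; rewrite leNgt.
    by rewrite ab.
  exists (A b); split; [by exists b | apply: Amono; exact: ltW | by [] | rewrite -AE].
  have [V [cV vV] [f bf]] := Fsucc c b (conj cb csucc).
  have [h hV] := countably_presented_gen cV.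
  pose pr : {linear submod (F b) -> subquot (F b) (F c)} := quotmap _.
  (* [psi p] is the class of [ev g p] in the filtration factor, carried to [V] by [f]; outside [A b]
     it has the default value 0. *)
  have /choice[psi psiP] p : exists v, forall y : submod (F b), val y = ev g p -> v = f (pr y).
    have [Ap|nA] := pselect (A b p); last first.
      by exists 0 => y yp; case: nA; rewrite /A /= -yp; exact: valP.
    by exists (f (pr (Sub (ev g p) Ap))) => y yp; congr (f (pr _)); exact: val_inj.
  apply: (@extends_very_flat_quot R hR _ V D _ _ psi h) => //.
  + move=> r p q Ap Aq.
    rewrite (psiP p (Sub (ev g p) Ap))// (psiP q (Sub (ev g q) Aq))//.
    have e : val (r *: Sub (ev g p) Ap + Sub (ev g q) Aq : submod (F b)) = ev g (r *: p + q).
      by rewrite linearP [RHS]linearP.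
    by rewrite (psiP _ _ e) linearP linearP.
  + by apply: Amono; exact: ltW.
  + move=> p Ap; rewrite (psiP p (Sub (ev g p) Ap))//.
    have -> : f (pr (Sub (ev g p) Ap)) = 0 <-> pr (Sub (ev g p) Ap) = 0.
      by split=> [e|->]; [apply: (bij_inj bf); rewrite e linear0 | rewrite linear0].
    rewrite -(linear0 pr); split=> [/quotmap_eq|Ac]; first by rewrite subr0.
    by apply/quotmap_eq; rewrite subr0.
Qed.

End Filtrations.

Section TrivialFiltration.
Variable R : idomainType.

(** The filtration of length 1, indexed by [false < true]. *)
Lemma countably_filtered_self (P : lmodType R -> Prop) (U : lmodType R) :
  P U -> countably_filtered P U.
Proof.
move=> PU; pose F (b : bool) : submodClosed U :=
  if b then mk_submod (is_submodT U) else mk_submod (is_submod_0 U).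
exists _, (bool : tbOrderType _), F; split; first exact: countableP.
split.
- move=> A [b Ab]; have [A0|A0] := boolP (false \in A).
    by exists false; split=> [|z [zA zmin]]; [split=> // | have := zmin _ A0; case: z {zA zmin}].
  exists true; split=> [|z [zA _]]; last by case: z zA A0 => // ->.
  by split=> [|z]; [case: b Ab A0 => // -> | case: z => // zA; rewrite zA in A0].
- by case=> -[] ab x //= _; apply/(mk_submodE (is_submodT U)).
- by move=> x; split; [exact: mk_submodE | exact/mk_submodE].
- by case=> -[b0 nsucc]; [case: nsucc; exists false; split=> // -[] | case: b0].
- case=> -[] [] // _ _; exists U => //.
  apply: (first_isomorphism (phi := val : {linear submod (F true) -> U})) => [u|x].
    by have Fu : u \in F true by [exact/mk_submodE]; exists (Sub u Fu).
  exact: (mk_submodE (is_submod_0 U) (val x)).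
Qed.

End TrivialFiltration.

(** * The five conditions *)

Section Equivalences.
Variable R : idomainType.
Hypothesis hR : dedekind_domain R.
Variable M : lmodType R.

Lemma very_flat_submod_sub (P N : submodClosed M) (c : nat -> M) :
  countably_generated (submod P) -> very_flat (submod P) ->
  (forall i, c i \in N) -> (forall x, x \in N -> exists p, x = ev c p) ->
  (forall i, c i \in P) -> very_flat (submod N).
Proof.
move=> /ctbl_gen_submod[g gP Pg] /(very_flat_submod gP Pg) vg cN Nc cP.
by apply/(very_flat_submod cN Nc); apply: very_flat_sub vg => // i; exact: (Pg _ (cP i)).
Qed.

Lemma very_flat_submod_torsion_free (P : submodClosed M) (a : R) x :
  countably_generated (submod P) -> very_flat (submod P) -> x \in P ->
  a != 0 -> a *: x = 0 -> x = 0.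
Proof.
move=> /ctbl_gen_submod[g gP Pg] /(very_flat_submod gP Pg) vg /Pg[p xp].
by apply: (very_flat_torsion_free hR vg); exists p.
Qed.

Lemma very_flat_seq_submod (P : submodClosed M) (c : nat -> M) :
  countably_generated (submod P) -> very_flat (submod P) -> (forall i, c i \in P) ->
  very_flat_seq c.
Proof.
move=> /ctbl_gen_submod[g gP Pg] /(very_flat_submod gP Pg) vg cP.
by apply: very_flat_sub vg => // i; exact: (Pg _ (cP i)).
Qed.

Definition pure_very_flat_cover (C : set M) : Prop :=
  exists N : submodClosed M,
    [/\ countably_generated (submod N), pure N, very_flat (submod N) & C `<=` [set` N]].

Lemma pure_cover_torsion_free :
  (forall F : set M, finite_set F -> pure_very_flat_cover F) ->
  forall (a : R) (x : M), a != 0 -> a *: x = 0 -> x = 0.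
Proof.
move=> hF a x; have [N [gN _ vN xN]] := hF [set x] (finite_set1 x).
by apply: (very_flat_submod_torsion_free gN vN); exact: (xN x erefl).
Qed.

(** A pure submodule containing the first [n] terms contains their torsion closure, and so the whole
    sequence, because [M] is torsion free. *)
Lemma pure_cover_finite_rank :
  (forall F : set M, finite_set F -> pure_very_flat_cover F) -> very_flat_finite_rank M.
Proof.
move=> hF c n Tc; have tfM := pure_cover_torsion_free hF.
have [|N [gN pN vN cN]] := hF [set` mkseq c n]; first by apply/finite_seqP; exists (mkseq c n).
apply: (very_flat_seq_submod gN vN) => i; have [a a0 [p pn e]] := Tc i.
apply: (pure_torsion_free pN tfM a0); rewrite e.
apply: (ev_in_size (submodClosed_is_submod N) _ pn) => j jn.
by apply: cN => /=; apply: map_f; rewrite mem_iota.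
Qed.

Lemma finite_rank_pure_cover : very_flat_finite_rank M ->
  forall C : set M, countable C -> pure_very_flat_cover C.
Proof.
move=> vM C /countable_enum[c Cc _].
have [g [gN Ng vg]] := hull_very_flat hR vM c.
exists (mk_submod (is_submod_hull c)).
have gN' i : g i \in mk_submod (is_submod_hull c) by apply/mk_submodE.
have Ng' x : x \in mk_submod (is_submod_hull c) -> exists p, x = ev g p.
  by move=> /mk_submodE/Ng.
split.
- by apply/ctbl_gen_submod; exists g.
- apply: (pure_divisible hR) => a x a0 /mk_submodE ax; apply/mk_submodE.
  exact: hull_divisible ax.
- exact/(very_flat_submod gN' Ng').
- by move=> x /Cc[i ->]; apply/mk_submodE; exact: hull_gen.
Qed.

Lemma submod_range_finite_rank (c : nat -> M) n : (forall i, torsion_over c n (c i)) ->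
  finite_rank (submod (mk_submod (is_submod_range_ev c))).
Proof.
move=> Tc; have cN i : c i \in mk_submod (is_submod_range_ev c).
  by apply/mk_submodE; exists 'X^i; rewrite // evX.
apply: (@torsion_over_finite_rank _ _ n (fun i => Sub (c i) (cN i))) => x.
have /mk_submodE[p _ xp] := valP x.
have [a a0 [q qn e]] : torsion_over c n (val x).
  by rewrite -xp; apply: ev_in => //; exact: is_submod_torsion_over.
exists a => //; exists q => //; apply: val_inj.
by rewrite linear_ev linearZ /= e; exact: eq_ev.
Qed.

End Equivalences.

Theorem theorem4p2 (R : idomainType) (M : lmodType R) (hR : dedekind_domain R) :
  [<-> forall F : set M, finite_set F ->
         exists N : submodClosed M,
           [/\ countably_generated (submod N), pure N,
               very_flat (submod N) & F `<=` [set` N]];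
       forall C : set M, countable C ->
         exists N : submodClosed M,
           [/\ countably_generated (submod N), pure N,
               very_flat (submod N) & C `<=` [set` N]];
       forall N : submodClosed M, finite_rank (submod N) ->
         very_flat (submod N);
       forall N : submodClosed M, countably_generated (submod N) ->
         very_flat (submod N);
       locally_very_flat M].
Proof.
have noethR := dedekind_noetherian hR.
split; first by move=> hF; apply: finite_rank_pure_cover => //; exact: pure_cover_finite_rank.
split.
  (* (ii) to (iii): a pure very flat [P] containing the finitely many [c i] that matter contains
     everything torsion over them, hence [N]. Being inside [P], [N] is also countably generated. *)
  move=> hC N /finite_rank_torsion_over[n [c Tc]].
  have tfM : forall (a : R) (x : M), a != 0 -> a *: x = 0 -> x = 0.
    by apply: pure_cover_torsion_free => // F /finite_set_countable; exact: hC.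
  have [P [gP pP vP cP]] := hC (range (val \o c)) (card_image_le _ _).
  have NP x : x \in N -> x \in P.
    move=> Nx; have [a a0 [p _ e]] := Tc (Sub x Nx).
    apply: (pure_torsion_free pP tfM a0).
    have -> : a *: x = ev (val \o c) p by rewrite -linear_ev -e linearZ.
    apply: (ev_in (submodClosed_is_submod P)) => i; exact: cP (imageT _ i).
  have [h hN Nh] : ctbl_gen [set` N].
    apply: (ctbl_gen_sub noethR (submodClosed_is_submod N) _ NP).
    exact/ctbl_gen_submod.
  by apply: (very_flat_submod_sub hR gP vP hN Nh) => i; exact/NP/hN.
split.
  (* (iii) to (iv): a sequence that is torsion over its first terms spans a submodule of finite
     rank, so the common criterion holds and puts [N] inside a very flat submodule. *)
  move=> hN N /ctbl_gen_submod[c cN Nc].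
  have vM : very_flat_finite_rank M.
    move=> d n Td; apply: (very_flat_submod _ _).1 (hN _ (submod_range_finite_rank Td)).
      by move=> i; apply/mk_submodE; exists 'X^i; rewrite // evX.
    by move=> x /mk_submodE[p _ <-]; exists p.
  have [P [gP _ vP cP]] := finite_rank_pure_cover hR vM (card_image_le c setT).
  by apply: (very_flat_submod_sub hR gP vP cN Nc) => i; exact: cP (imageT _ i).
split.
  (* (iv) to (v): the dense system consists of all countably generated submodules, each with the
     filtration of length 1. *)
  move=> hN; pose S (N : submodClosed M) := countably_generated (submod N).
  have Scp N : S N -> countably_presented (submod N).
    by move=> /ctbl_gen_ev[g gN]; exact: countably_generated_presented gN.
  exists S => [|N SN]; last by apply: countably_filtered_self; split; [exact: Scp | exact: hN].
  split=> // [d T F _ cT [a0 _] Fmono SF|C /countable_enum[c Cc _]].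
  - have sU : is_submod [set x | exists a, x \in F a].
      split=> [|r x y [a Fx] [b Fy]]; first by exists a0; exact: rpred0.
      have [ab|ba] := leP a b.
        by exists b; apply: rpredD => //; apply: rpredZ; exact: Fmono Fx.
      by exists a; rewrite rpredD ?rpredZ//; apply: Fmono Fy; exact: ltW.
    exists (mk_submod sU); last by move=> x; exact: mk_submodE.
    have /countable_injP[e einj] := cT.
    (* The countable index type is enumerated by the naturals, with [a0] as value at numbers that
       code no index. *)
    have /choice[i iP] n : exists i : T, (exists2 a, e a = n & i = a) \/ ~ exists a, e a = n.
      have [[a ea]|h] := pselect (exists a, e a = n); first by exists a; left; exists a.
      by exists a0; right.
    have UE : [set x | exists a, x \in F a] = \bigcup_n [set` F (i n)].
      apply/seteqP; split=> x [a /=]; last by move=> _ Fx; exists (i a).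
      move=> Fx; exists (e a) => //=; case: (iP (e a)) => [[b eb ->]|[]]; last by exists a.
      by rewrite (_ : b = a)//; apply: einj; rewrite ?inE.
    apply/ctbl_gen_submod; have -> : [set` mk_submod sU] = \bigcup_n [set` F (i n)].
      by rewrite -UE; apply/seteqP; split=> x h; exact/(mk_submodE sU).
    by apply: ctbl_gen_bigcup; [rewrite -UE | move=> n; apply/ctbl_gen_submod; exact: SF].
  - exists (mk_submod (is_submod_range_ev c)).
      apply/ctbl_gen_submod; exists c => [i|x /mk_submodE[p _ <-]]; last by exists p.
      by apply/mk_submodE; exists 'X^i; rewrite // evX.
    by move=> x /Cc[i ->]; apply/mk_submodE; exists 'X^i; rewrite // evX.
(* (v) to (i): a member of the dense system contains the given sequence and is very flat by its
   filtration, which passes to the submodule spanned by the sequence. *)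
move=> [S [Scp _ SC] Sfilt] F /finite_set_countable cF.
apply: finite_rank_pure_cover => // c n _.
have [N SN cN] := SC (range c) (card_image_le _ _).
have [g gN] := countably_presented_gen (Scp N SN).
have vN := filtered_very_flat hR gN (Sfilt N SN).
apply: (very_flat_seq_submod hR _ vN) => [|i]; last exact: cN (imageT _ i).
by apply/ctbl_gen_ev; exists g.
Qed.
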